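(* Let $S=\{x_1,\dots,x_{d+2}\}$ be a set of $n=d+2$ points in general position in $\mathbb{R}^d$, and let $t_1,t_2$ be its two triangulations. Then the triangulation of $S$ minimizing the discrete Dirichlet functional $DF(\cdot,Y)$ does not depend on $Y$; that is, there is a triangulation $t^*\in\{t_1,t_2\}$ such that for every $Y=(y_1,\dots,y_{d+2})\in\mathbb{R}^{d+2}$, $$DF(t^*,Y)=\min\{DF(t_1,Y),DF(t_2,Y)\}.$$
   Context: General position: no $d+1$ of the points lie on a common hyperplane and no $d+2$ lie on a common sphere. A triangulation of $S$ is a triangulation of the convex hull $CH(S)$ whose vertices belong to $S$; a set of $d+2$ points in general position in $\mathbb{R}^d$ has exactly two triangulations. For a triangulation $t$ of $S$ and real numbers $Y=(y_1,\dots,y_n)$, with $y_i$ associated to $x_i$, let $f=f_{t,Y}:CH(S)\to\mathbb{R}$ be the continuous function that is affine on each simplex of $t$ and satisfies $f(x_i)=y_i$ at each vertex $x_i$ of $t$. The discrete Dirichlet functional is $$DF(t,Y)=\int_{CH(S)}\|\operatorname{grad} f(x)\|^2\,dx.$$ A triangulation of $S$ minimizing $DF(\cdot,Y)$ over all triangulations of $S$ is called optimal, or a discrete spline triangulation (DST). *)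

(* Defs.v *)
From HB Require Import structures.
From mathcomp Require Import all_boot all_order all_algebra.
From mathcomp Require Import all_classical all_reals all_analysis.

Set Implicit Arguments.
Unset Strict Implicit.
Unset Printing Implicit Defensive.

Import Order.TTheory GRing.Theory Num.Theory.
Import numFieldNormedType.Exports.

Local Open Scope classical_set_scope.
Local Open Scope ring_scope.

Section LebesgueTuple.
Context {R : realType}.
Notation T := (measurableTypeR R).

Definition tcons n (p : T * n.-tuple T) : n.+1.-tuple T :=
  [the n.+1.-tuple T of p.1 :: p.2].

Lemma measurable_tcons n : measurable_fun [set: T * n.-tuple T] (@tcons n).
Proof.
exact: (measurable_cons (@measurable_fst _ _ T _) (@measurable_snd _ _ T _)).
Qed.

Section Step.
Variables (n : nat) (m : {sigma_finite_measure set (n.-tuple T) -> \bar R}).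

Definition lebesgueS : set (n.+1.-tuple T) -> \bar R :=
  pushforward (@lebesgue_measure R \x m)%E (@tcons n).

Let lebesgueS0 : lebesgueS set0 = 0%E.
Proof. by rewrite /lebesgueS /pushforward preimage_set0 measure0. Qed.

Let lebesgueS_ge0 A : (0 <= lebesgueS A)%E.
Proof. by rewrite /lebesgueS /pushforward measure_ge0. Qed.

Let lebesgueS_sigma_additive : semi_sigma_additive lebesgueS.
Proof.
move=> F mF tF mUF; rewrite /lebesgueS /pushforward preimage_bigcup.
apply: measure_semi_sigma_additive.
- by move=> i; rewrite -[X in measurable X]setTI; exact: measurable_tcons.
- apply/trivIsetP => /= i j _ _ ij; rewrite -preimage_setI.
  by move/trivIsetP : tF => /(_ _ _ _ _ ij) ->//; rewrite preimage_set0.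
- by rewrite -preimage_bigcup -[X in measurable X]setTI; exact: measurable_tcons.
Qed.

HB.instance Definition _ := isMeasure.Build _ _ _ lebesgueS
  lebesgueS0 lebesgueS_ge0 lebesgueS_sigma_additive.

Let lebesgueS_sigma_finite : sigma_finite [set: n.+1.-tuple T] lebesgueS.
Proof.
have /sigma_finiteP[F [TF ndF Foo]] := sigma_finiteT (@lebesgue_measure R).
have /sigma_finiteP[G [TG ndG Goo]] := sigma_finiteT m.
pose H k := [set v : n.+1.-tuple T | F k (thead v) /\ G k [tuple of behead v]].
have tK v : [tuple of behead (@tcons n v)] = v.2 by exact: val_inj.
have HE k : @tcons n @^-1` H k = F k `*` G k.
  by apply/seteqP; split=> -[a b] /=; rewrite /H /= tK.
exists H.
  apply/esym/seteqP; split=> // v _.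
  have [i _ Fi] : (\bigcup_i F i) (thead v) by rewrite -TF.
  have [j _ Gj] : (\bigcup_j G j) [tuple of behead v] by rewrite -TG.
  exists (maxn i j) => //; split.
    by move: (thead v) Fi; exact/subsetPset/ndF/leq_maxl.
  by move: [tuple of behead v] Gj; exact/subsetPset/ndG/leq_maxr.
move=> k; have [mF Fk] := Foo k; have [mG Gk] := Goo k; split.
  apply: measurableI.
    rewrite -[X in measurable X]setTI.
    exact: (@measurable_tnth _ T n.+1 ord0 measurableT _ mF).
  rewrite -[X in measurable X]setTI.
  exact: (@measurable_behead _ T n measurableT _ mG).
rewrite /lebesgueS /pushforward HE product_measure1E//.
by rewrite lte_mul_pinfty// ge0_fin_numE.
Qed.

HB.instance Definition _ := Measure_isSigmaFinite.Build _ _ _ lebesgueS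
  lebesgueS_sigma_finite.

End Step.

(* d-dimensional Lebesgue measure, on the product sigma-algebra of R^d: the
   d-fold product of the Lebesgue measure of R (a unit mass on the one-point
   space R^0), transported along R * R^n ~ R^n.+1. *)
Fixpoint lebesgue_tuple (d : nat) :
    {sigma_finite_measure set (d.-tuple T) -> \bar R} :=
  match d with
  | 0 => \d_([tuple] : 0.-tuple T)
  | n.+1 => lebesgueS (lebesgue_tuple n)
  end.

End LebesgueTuple.

Definition rV_of_tuple {R : realType} {d : nat}
    (u : d.-tuple (measurableTypeR R)) : 'rV[R]_d :=
  \row_i (tnth u i : R).

Section DirichletTriangulation.
Context {R : realType} {d : nat}.
Implicit Types (u v z : 'rV[R]_d).

Definition dotp u v : R := \sum_i u 0 i * v 0 i.

(* Squared Euclidean norm; the norm [`|z|] of 'rV[R]_d is the sup norm. *)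
Definition sqnorm z : R := dotp z z.

Section Points.
Context {n : nat}.
Variable x : 'I_n -> 'rV[R]_d.
Implicit Types (A s : {set 'I_n}) (t : {set {set 'I_n}}) (Y : 'I_n -> R).

Definition on_hyperplane A : Prop :=
  exists a b, a != 0 /\ forall i, i \in A -> dotp a (x i) = b.

Definition on_sphere A : Prop :=
  exists c (r : R), 0 < r /\ forall i, i \in A -> sqnorm (x i - c) = r ^+ 2.

Definition general_position : Prop :=
  [/\ injective x,
      forall A, #|A| = d.+1 -> ~ on_hyperplane A
    & forall A, #|A| = d.+2 -> ~ on_sphere A].

Definition conv A : set 'rV[R]_d :=
  [set z | exists w : 'I_n -> R,
    [/\ forall i, i \in A -> 0 <= w i, \sum_(i in A) w i = 1
      & z = \sum_(i in A) w i *: x i]].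

(* A triangulation is given by its d-dimensional simplices, each simplex by the
   set of indices of its d+1 vertices; it need not use all the points. *)
Definition is_triangulation t : Prop :=
  [/\ forall s, s \in t -> #|s| = d.+1 /\ ~ on_hyperplane s,
      \bigcup_(s in [set` t]) conv s = conv [set: 'I_n]
    & forall s s', s \in t -> s' \in t ->
        conv s `&` conv s' = conv (s :&: s')].

(* Uniquely determined on the convex hull of the points by the first three
   clauses; the last one fixes the values outside it. *)
Definition is_interpolant t Y (f : 'rV[R]_d -> R) : Prop :=
  [/\ {within conv [set: 'I_n], continuous f},
      forall s, s \in t ->
        exists a b, forall z, conv s z -> f z = dotp a z + b,
      forall s i, s \in t -> i \in s -> f (x i) = Y i
    & forall z, ~ conv [set: 'I_n] z -> f z = 0].

Definition interpolant t Y : 'rV[R]_d -> R :=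
  xget (fun=> 0) [set f | is_interpolant t Y f].

End Points.

(* The partial derivatives are total; the value given to them where they do not
   exist is irrelevant below, since this happens only on a null set. *)
Definition grad (f : 'rV[R]_d -> R) z : 'rV[R]_d :=
  \row_i 'D_(delta_mx 0 i) f z.

Definition DF {n : nat} (x : 'I_n -> 'rV[R]_d) (t : {set {set 'I_n}})
    (Y : 'I_n -> R) : \bar R :=
  (\int[lebesgue_tuple d]_(u in rV_of_tuple @^-1` conv x [set: 'I_n])
     (sqnorm (grad (interpolant x t Y) (rV_of_tuple u)))%:E)%E.

End DirichletTriangulation.

(* Main.v *)
Require Import Defs.
From HB Require Import structures.
From mathcomp Require Import all_boot all_order all_algebra.
From mathcomp Require Import all_classical all_reals all_analysis.
From mathcomp Require Import measurable_realfun.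
From mathcomp Require Import ring lra.

Set Implicit Arguments.
Unset Strict Implicit.
Unset Printing Implicit Defensive.

Import Order.TTheory GRing.Theory Num.Theory.
Import numFieldNormedType.Exports.
Local Open Scope classical_set_scope.
Local Open Scope ring_scope.

(** Up to a scalar the points have exactly one affine dependence [lam], and all
    its coefficients are nonzero. Fix weights [w i z], affine in [z], with
    [\sum_i w i z = 1] and [\sum_i w i z *: x i = z]. The representations of [z]
    as an affine combination of the points are the families [w i z - c * lam i],
    so in terms of the ratios [mu i := w i / lam i] a scalar [c] gives a convex
    combination exactly when [mu j z <= c <= mu i z] for all [i], [j] with
    [lam j < 0 < lam i]. Thus the hull is the set where the largest [mu j] is at
    most the smallest [mu i] ([conv_setTP]), and the simplex that omits the
    vertex [i] is the part of it where that minimum is attained at [i]. A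
    simplex omitting a vertex of positive coefficient and one omitting a vertex
    of negative coefficient both contain the Radon point, which is not in the
    hull of their common vertices; so a triangulation only omits vertices of one
    sign ([triangulation_signs]).

    Consequently the interpolant of [Y] is [L - C * min mu] for one sign and
    [L - C * max mu] for the other, with [L := \sum_k Y k * w k] affine and
    [C := \sum_k lam k * Y k] ([interpolantE]). On the chamber where the minimum
    is attained at [i] only and the maximum at [j] only, the two gradients are
    [a - C *: b i] and [a - C *: b j], where [a] and [b k] are the gradients of
    [L] and [mu k] ([grad_interpolant]). The chambers fill the hull up to
    hyperplanes, so if [V i j] are their volumes then the two values of the
    functional are the sums of [V i j * |a - C *: b i|^2] and of
    [V i j * |a - C *: b j|^2] ([DF_energy]). Their difference is [- 2 * C]
    times the sum of [V i j * (a . (b i - b j))], plus [C ^+ 2] times the sum of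
    [V i j * (|b i|^2 - |b j|^2)].

    The first sum vanishes, and this is the heart of the matter: it is the
    integral of the derivative along [a] of the function
    [h := max 0 (min mu - max mu)], which is Lipschitz and vanishes outside the
    hull. By translation invariance of Lebesgue measure every difference
    quotient of [h] has integral zero, and dominated convergence passes to the
    limit ([integral_fibre_derivative]). (In other words, two piecewise affine
    functions that agree on the boundary have the same mean gradient.) What
    remains is [C ^+ 2] times a constant that does not involve [Y], and the sign
    of this constant decides which triangulation is optimal. *)

Local Notation conv := Defs.conv.
Local Notation pushforward_measure :=
  measure_function_pushforward__canonical__measure_function_Measure.

(** * Affine functions and their gradients *)

Section Affine.
Context {R : realType} {d : nat}.
Implicit Types (a b u v z : 'rV[R]_d) (c : R).

Lemma dotpDl u v z : dotp (u + v) z = dotp u z + dotp v z.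
Proof. by rewrite -big_split; apply: eq_bigr => i _; rewrite mxE mulrDl. Qed.

Lemma dotpDr u v z : dotp u (v + z) = dotp u v + dotp u z.
Proof. by rewrite -big_split; apply: eq_bigr => i _; rewrite mxE mulrDr. Qed.

Lemma dotpZl c u v : dotp (c *: u) v = c * dotp u v.
Proof. by rewrite mulr_sumr; apply: eq_bigr => i _; rewrite mxE mulrA. Qed.

Lemma dotpC u v : dotp u v = dotp v u.
Proof. by apply: eq_bigr => i _; rewrite mulrC. Qed.

Lemma dotpZr c u v : dotp u (c *: v) = c * dotp u v.
Proof. by rewrite dotpC dotpZl dotpC. Qed.

Lemma dotp0l v : dotp 0 v = 0.
Proof. by rewrite -(scale0r 0) dotpZl mul0r. Qed.

Lemma dotpNl u v : dotp (- u) v = - dotp u v.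
Proof. by rewrite -scaleN1r dotpZl mulN1r. Qed.

Lemma dotp_suml I (r : seq I) (P : pred I) (F : I -> 'rV[R]_d) v :
  dotp (\sum_(i <- r | P i) F i) v = \sum_(i <- r | P i) dotp (F i) v.
Proof.
by apply: (big_morph (dotp^~ v)) => [u w|]; rewrite ?dotpDl ?dotp0l.
Qed.

Lemma dotp_sumr I (r : seq I) (P : pred I) (F : I -> 'rV[R]_d) v :
  dotp v (\sum_(i <- r | P i) F i) = \sum_(i <- r | P i) dotp v (F i).
Proof. by rewrite dotpC dotp_suml; apply: eq_bigr => i _; rewrite dotpC. Qed.

Lemma sqnorm_ge0 (z : 'rV[R]_d) : 0 <= sqnorm z.
Proof. by apply: sumr_ge0 => i _; rewrite -expr2 sqr_ge0. Qed.

Lemma sqnormB_scale (a b : 'rV[R]_d) c :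
  sqnorm (a - c *: b) = sqnorm a - 2 * c * dotp b a + c ^+ 2 * sqnorm b.
Proof.
rewrite /sqnorm -scaleNr dotpDl !dotpDr !dotpZl !dotpZr (dotpC a b); ring.
Qed.

Definition affine a c z : R := dotp a z + c.

Lemma affineD b c z v : affine b c (z + v) = affine b c z + dotp b v.
Proof. by rewrite /affine dotpDr addrAC. Qed.

Lemma affine_comb n (x : 'I_n -> 'rV[R]_d) (A : {set 'I_n})
    (w : 'I_n -> R) b c :
  \sum_(i in A) w i = 1 ->
  affine b c (\sum_(i in A) w i *: x i) = \sum_(i in A) w i * affine b c (x i).
Proof.
move=> sw; under [RHS]eq_bigr do rewrite mulrDr -dotpZr.
by rewrite big_split/= -mulr_suml sw mul1r -dotp_sumr.
Qed.

Lemma continuous_affine b c : continuous (affine b c).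
Proof.
have cb : continuous (fun z : 'rV[R]_d => \sum_i b 0 i * z 0 i).
  apply: continuous_big => [|i _ y]; first exact: add_continuous.
  by apply: continuousM; [exact: cst_continuous|exact: coord_continuous].
move=> z; apply: (@continuousD _ _ _ (dotp b) (fun=> c)); first exact: cb.
exact: cst_continuous.
Qed.

Lemma near_affine_lt b c b' c' z : affine b c z < affine b' c' z ->
  \forall y \near z, affine b c y < affine b' c' y.
Proof.
rewrite -subr_gt0 => h.
have cont : {for z, continuous (fun y => affine b' c' y - affine b c y)}.
  apply: (@continuousB _ _ _ (affine b' c') (affine b c));
    exact: continuous_affine.
by near do rewrite -subr_gt0; exact: (cvgr_gt _ cont _ h).
Unshelve. all: by end_near. Qed.

(** The difference quotients that define the partial derivatives are eventually
    constant. *)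
Lemma grad_near_affine (f : 'rV[R]_d -> R) b c z :
  (\forall y \near z, f y = affine b c y) -> grad f z = b.
Proof.
move=> fE; apply/rowP => i; rewrite mxE (near_eq_derive _ fE).
rewrite /derive; apply: cvg_lim => //; apply: cvg_near_cst.
near=> h; have h0 : h != 0 by near: h; exact: nbhs_dnbhs_neq.
rewrite /= [_ + z]addrC affineD [affine b c z + _]addrC addrK dotpZr.
rewrite scalerA mulVf// scale1r /dotp (bigD1 i)//= mxE !eqxx mulr1.
rewrite big1 ?addr0//.
by move=> k /negPf ki; rewrite mxE ki andbF mulr0.
Unshelve. all: by end_near. Qed.

End Affine.

(** * Finite combinations of measurable sets, and integrals off a null set *)

Section FiniteMeasurability.
Context d (X : measurableType d) (R : realType).

Lemma measurable_forall (K : finType) (P : K -> X -> Prop) :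
  (forall i, measurable [set u | P i u]) ->
  measurable [set u | forall i, P i u].
Proof.
move=> mP; have -> : [set u | forall i, P i u] =
    \bigcap_(i in [set: K]) [set u | P i u].
  by apply/seteqP; split => u Pu i; [move=> _; exact: Pu|exact: (Pu i I)].
exact: fin_bigcap_measurable.
Qed.

(** A guard that depends on the indices only: either all of the space or the
    guarded set. *)
Lemma measurable_imply (b : bool) (P : X -> Prop) :
  measurable [set u | P u] -> measurable [set u | b -> P u].
Proof.
case: b => mP.
  rewrite (_ : mkset _ = [set u | P u])//.
  by apply/seteqP; split=> u /=; [exact|].
by rewrite (_ : mkset _ = setT)//; apply/seteqP; split.
Qed.

Lemma measurable_set_lt (f g : X -> R) : measurable_fun setT f ->
  measurable_fun setT g -> measurable [set u | f u < g u].
Proof.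
move=> mf mg; rewrite -[X in measurable X]setTI.
exact: (measurable_fun_ltr mf mg measurableT (Y := [set true])).
Qed.

End FiniteMeasurability.

Section NonnegativeIntegrals.
Local Open Scope ereal_scope.
Context d (X : measurableType d) (R : realType).
Variable mu : {measure set X -> \bar R}.
Import HBNNSimple.

(** Stated for arbitrary functions because the gradient of an interpolant takes
    uncontrolled values on the walls. A simple function below [f] can be set to
    zero on [N] without changing its integral, and is then below [g]. *)
Lemma ge0_le_integral_off_null (N : set X) (f g : X -> \bar R) :
  measurable N -> mu N = 0 -> (forall x, 0 <= f x) -> (forall x, 0 <= g x) ->
  (forall x, ~ N x -> f x <= g x) -> \int[mu]_x f x <= \int[mu]_x g x.
Proof.
move=> mN N0 f0 g0 fg.
rewrite !ge0_integralTE// ge_ereal_sup// => _ [h/= hf <-].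
have mCN := measurableC mN.
apply: le_ereal_sup_tmp; exists (sintegral mu (proj_nnsfun h mCN)).
  exists (proj_nnsfun h mCN) => //= x; rewrite mindicE.
  have [xN|xN] := boolP (x \in ~` N); last by rewrite mulr0.
  by rewrite mulr1 (le_trans (hf x))// fg//; move: xN; rewrite inE.
rewrite -!integralT_nnsfun (ge0_negligible_integral mN)//; last 2 first.
- by apply/measurable_EFinP.
- by move=> x _; rewrite lee_fin.
rewrite setTD integral_mkcond le_eqVlt; apply/orP; left; apply/eqP.
apply: eq_integral => x _; rewrite /= patchE mindicE.
by case: ifPn => _; rewrite /= ?mulr1 ?mulr0.
Qed.

Lemma ge0_eq_integral_off_null (N : set X) (f g : X -> \bar R) :
  measurable N -> mu N = 0 -> (forall x, 0 <= f x) -> (forall x, 0 <= g x) ->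
  (forall x, ~ N x -> f x = g x) -> \int[mu]_x f x = \int[mu]_x g x.
Proof.
move=> mN N0 f0 g0 fg; apply/eqP.
rewrite eq_le !(ge0_le_integral_off_null mN)//.
  by move=> x /fg ->.
by move=> x /fg ->.
Qed.

Lemma integrable_scaled_indic (c : R) (A : set X) :
  measurable A -> mu A < +oo ->
  mu.-integrable setT (fun u => (c * \1_A u)%:E).
Proof.
move=> mA Aoo; under eq_fun do rewrite EFinM.
apply: integrableZl => //; apply/integrableP; split.
  by apply/measurable_EFinP; exact: measurable_indic.
rewrite (eq_integral (fun u => (\1_A u)%:E)) ?integral_indic ?setIT// => u _.
by rewrite gee0_abs// lee_fin.
Qed.

Lemma integral_step (I : finType) (c : I -> R) (A : I -> set X) :
  (forall i, measurable (A i)) -> (forall i, mu (A i) < +oo) ->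
  \int[mu]_u (\sum_i c i * \1_(A i) u)%:E = (\sum_i c i * fine (mu (A i)))%:E.
Proof.
move=> mA Aoo; under eq_integral do rewrite -sumEFin.
rewrite integral_sum//=; last by move=> i; exact: integrable_scaled_indic.
rewrite -sumEFin; apply: eq_bigr => i _.
under eq_integral do rewrite EFinM.
rewrite integralZl//; last first.
  have := integrable_scaled_indic 1 (mA i) (Aoo i).
  by under eq_fun do rewrite mul1r.
by rewrite integral_indic// setIT EFinM fineK// ge0_fin_numE.
Qed.

End NonnegativeIntegrals.

(** * Lebesgue measure on tuples *)

Section LebesgueTuple.
Context (R : realType).
Notation T := (measurableTypeR R).

Lemma measurable_addr (c : R) : measurable_fun setT (fun y : T => y + c : T).
Proof. by apply: measurable_funD => //; exact: measurable_cst. Qed.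

(** A measure on the line is determined by its values on half-open intervals,
    and a translation preserves their lengths. *)
Lemma lebesgue_measure_addr (c : R) (A : set T) : measurable A ->
  lebesgue_measure ((fun y : T => y + c : T) @^-1` A) = lebesgue_measure A.
Proof.
move=> mA; apply/esym; have mc := measurable_addr c.
pose nu : {measure set T -> \bar R} :=
  pushforward_measure (@lebesgue_measure R) mc.
apply: (lebesgue_measure_unique (mu := nu)) mA => _ /ocitvP[->|[[a b]/= ab ->]].
  by rewrite !measure0.
rewrite /nu /= /pushforward.
have -> : (fun y : T => y + c : T) @^-1` `]a, b] = `]a - c, b - c]%classic.
  by apply/seteqP; split=> y /=; rewrite !in_itv/= ltrBlDr lerBrDr.
rewrite !lebesgue_measure_itv/= !lte_fin ltrD2r ab -!EFinD; congr (_%:E); ring.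
Qed.

Definition addt n (v u : n.-tuple T) : n.-tuple T :=
  [tuple (tnth u i + tnth v i : T) | i < n].

Lemma tnth_addt n (v u : n.-tuple T) i :
  tnth (addt v u) i = tnth u i + tnth v i.
Proof. by rewrite tnth_mktuple. Qed.

Lemma measurable_addt n (v : n.-tuple T) : measurable_fun setT (addt v).
Proof.
apply/measurable_fun_tnthP => i /=.
rewrite (_ : _ \o _ = fun u => tnth u i + tnth v i); last first.
  by apply/funext => u /=; rewrite tnth_addt.
apply: measurable_funD; last exact: measurable_cst.
exact: measurable_tnth.
Qed.

(** By uniqueness of the product measure it suffices to translate rectangles,
    factor by factor. *)
Lemma lebesgue_tuple_add n (v : n.-tuple T) (A : set (n.-tuple T)) :
  measurable A -> lebesgue_tuple n (addt v @^-1` A) = lebesgue_tuple n A.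
Proof.
elim: n v A => [|n IH] v A mA.
  suff -> : addt v @^-1` A = A by [].
  by apply/seteqP; split=> u /=; rewrite (tuple0 (addt v u)) (tuple0 u).
rewrite /= /lebesgueS /pushforward.
set c := tnth v ord0 : R; set v' := [tuple of behead v].
(* The translation by [v], seen on pairs of a head and a tail. *)
pose phi (p : T * n.-tuple T) : T * n.-tuple T := (p.1 + c, addt v' p.2).
have mphi : measurable_fun setT phi.
  apply: measurable_fun_pair; last first.
    by apply: (measurableT_comp (measurable_addt v')); exact: measurable_snd.
  by apply: (measurableT_comp (measurable_addr c)); exact: measurable_fst.
have -> : @tcons R n @^-1` (addt v @^-1` A) = phi @^-1` (@tcons R n @^-1` A).
  have tE p : addt v (tcons p) = tcons (phi p).
    apply: eq_from_tnth => i; rewrite tnth_addt.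
    case: (unliftP ord0 i) => [j ->|->]; last by rewrite !tnth0.
    by rewrite !tnthS tnth_addt; congr (_ + _); rewrite (tuple_eta v) tnthS.
  by apply/seteqP; split=> p /=; rewrite tE.
pose nu : {measure set (T * n.-tuple T) -> \bar R} :=
  pushforward_measure (@lebesgue_measure R \x lebesgue_tuple n)%E mphi.
have mB : measurable (@tcons R n @^-1` A).
  by rewrite -[X in measurable X]setTI; exact: measurable_tcons.
rewrite -[LHS]/(nu _) -(@product_measure_unique _ _ _ _ _ (@lebesgue_measure R)
  (lebesgue_tuple n) nu)// => A1 A2 mA1 mA2.
rewrite /nu /= /pushforward.
have -> : phi @^-1` (A1 `*` A2) =
    ((fun y : T => y + c : T) @^-1` A1) `*` (addt v' @^-1` A2).
  by apply/seteqP; split.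
rewrite product_measure1E; last 2 first.
- by rewrite -[X in measurable X]setTI; apply: measurable_addr.
- by rewrite -[X in measurable X]setTI; apply: measurable_addt.
rewrite IH//; congr (_ * _)%E; exact: lebesgue_measure_addr.
Qed.

Lemma ge0_integral_translate n (v : n.-tuple T) (f : n.-tuple T -> \bar R) :
  measurable_fun setT f -> (forall u, 0 <= f u)%E ->
  (\int[lebesgue_tuple n]_u f (addt v u) = \int[lebesgue_tuple n]_u f u)%E.
Proof.
move=> mf f0.
transitivity (\int[pushforward (lebesgue_tuple n) (addt v)]_u f u)%E.
  by rewrite ge0_integral_pushforward//; exact: measurable_addt.
pose nu : {measure set (n.-tuple T) -> \bar R} :=
  pushforward_measure (lebesgue_tuple n) (measurable_addt v).
apply: (@eq_measure_integral _ _ _ _ (lebesgue_tuple n) nu) => A mA _.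
exact: lebesgue_tuple_add.
Qed.

Definition box n (B : R) : set (n.-tuple T) :=
  [set u | forall i, `[- B, B]%classic (tnth u i)].

Lemma measurable_box n B : measurable (@box n B).
Proof.
apply: (measurable_forall (P := fun i u => `[- B, B]%classic (tnth u i))) => i.
by rewrite -[X in measurable X]setTI; exact: measurable_tnth.
Qed.

Lemma lebesgue_tuple_box_lty n B : (lebesgue_tuple n (@box n B) < +oo)%E.
Proof.
elim: n => [|n IH]; first by rewrite /= diracE; case: (_ \in _); rewrite ltry.
rewrite /= /lebesgueS /pushforward.
have -> : @tcons R n @^-1` box B = `[- B, B]%classic `*` box B.
  apply/seteqP; split=> [[a u] /= H|[a u] /= [Ha Hu] i].
    split; first by have := H ord0; rewrite tnth0.
    by move=> i; have := H (lift ord0 i); rewrite tnthS.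
  case: (unliftP ord0 i) => [j ->|->]; last by rewrite tnth0.
  by rewrite tnthS.
rewrite product_measure1E//; last exact: measurable_box.
apply: lte_mul_pinfty => //; rewrite ge0_fin_numE//= lebesgue_measure_itv/=.
by case: ifP; rewrite ?ltry// -EFinB ltry.
Qed.

Lemma measurable_affine n (b : 'I_n -> R) (c : R) :
  measurable_fun setT (fun u : n.-tuple T => \sum_i b i * tnth u i + c).
Proof.
apply: measurable_funD; last exact: measurable_cst.
apply: measurable_sum => i; apply: measurable_funM; first exact: measurable_cst.
exact: measurable_tnth.
Qed.

(** If a coefficient beyond the first one is nonzero, every section at a fixed
    first coordinate is a hyperplane in one dimension less; otherwise the
    hyperplane is a point of the line times the whole remaining space. *)
Lemma lebesgue_tuple_hyperplane n (b : 'I_n -> R) (c : R) i : b i != 0 ->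
  lebesgue_tuple n [set u | \sum_j b j * tnth u j + c = 0] = 0%E.
Proof.
elim: n b c i => [b c []//|n IH] b c i bi0.
have mH : measurable [set u : n.+1.-tuple T | \sum_j b j * tnth u j + c = 0].
  rewrite -[X in measurable X]setTI.
  exact: (measurable_affine b c measurableT (measurable_set1 0)).
rewrite /= /lebesgueS /pushforward.
have HE : @tcons R n @^-1` [set u | \sum_j b j * tnth u j + c = 0] =
    [set p | \sum_j b (lift ord0 j) * tnth p.2 j + (b ord0 * p.1 + c) = 0].
  have SE p : \sum_j b j * tnth (tcons p) j + c =
      \sum_j b (lift ord0 j) * tnth p.2 j + (b ord0 * p.1 + c).
    rewrite big_ord_recl tnth0 addrAC addrC; congr (_ + _).
    by apply: eq_bigr => j _; rewrite tnthS.
  by apply/seteqP; split=> p /=; rewrite SE.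
have [[j bj]|b0] := pselect (exists j, b (lift ord0 j) != 0).
  rewrite /product_measure1 integral0_eq// => y _ /=.
  rewrite HE xsectionE.
  exact: (IH (fun j => b (lift ord0 j)) (b ord0 * y + c) j bj).
have {}b0 j : b (lift ord0 j) = 0.
  by apply/eqP/negPn/negP => bj; apply: b0; exists j.
have {}bi0 : b ord0 != 0.
  by move: bi0; case: (unliftP ord0 i) => [j ->|->//]; rewrite b0 eqxx.
have -> : @tcons R n @^-1` [set u | \sum_j b j * tnth u j + c = 0] =
    [set - c / b ord0] `*` setT.
  have S0 p : \sum_j b (lift ord0 j) * tnth (p : T * n.-tuple T).2 j = 0.
    by rewrite big1// => j _; rewrite b0 mul0r.
  rewrite HE; apply/seteqP; split=> [p|p [/= p1 _]] /=; rewrite S0 add0r.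
    move=> /eqP; rewrite addr_eq0 => /eqP <-; split => //=.
    by rewrite mulrAC divff ?mul1r.
  by rewrite p1 mulrCA divff// mulr1 addNr.
by rewrite product_measure1E// [X in (X * _)%E](lebesgue_measure_set1) mul0e.
Qed.

End LebesgueTuple.

(** * Affine dependence of points in general position *)

Section Radon.
Context {R : realType} {d : nat}.

Section Homogeneous.
Context {n : nat} (x : 'I_n -> 'rV[R]_d).

Definition homogeneous_mx : 'M[R]_(n, 1 + d) :=
  \matrix_i row_mx (1 : 'rV_1) (x i).

Lemma mul_homogeneous_mx (w : 'rV_n) :
  w *m homogeneous_mx = row_mx (\sum_i w 0 i)%:M (\sum_i w 0 i *: x i).
Proof.
rewrite mulmx_sum_row; under eq_bigr do rewrite rowK.
apply/rowP => j; rewrite summxE; case: (split_ordP j) => k ->.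
  rewrite row_mxEl ord1 [RHS]mxE mulr1n; apply: eq_bigr => i _.
  by rewrite mxE row_mxEl mxE mulr1.
rewrite row_mxEr summxE; apply: eq_bigr => i _.
by rewrite [RHS]mxE mxE row_mxEr.
Qed.

Lemma homogeneous_mx_mulT (v : 'rV_(1 + d)) i :
  (v *m homogeneous_mx^T) 0 i = v 0 (lshift d 0) + dotp (rsubmx v) (x i).
Proof.
rewrite mxE big_split_ord big_ord1; congr (_ + _).
  by rewrite 2!mxE row_mxEl mxE mulr1.
by apply: eq_bigr => k _; rewrite 2!mxE row_mxEr [in RHS]mxE.
Qed.

End Homogeneous.

(** A nonzero vector in the kernel of the homogeneous matrix is the coefficient
    vector of an affine function that vanishes at all the points. It may be
    constant in [z], hence the disjunction: this is excluded as soon as there is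
    a point. *)
Lemma exists_affine_zero n (x : 'I_n -> 'rV[R]_d) :
  ~~ row_full (homogeneous_mx x) ->
  exists a b, (a != 0 \/ b != 0) /\ forall i, dotp a (x i) = b.
Proof.
rewrite /row_full -mxrank_tr -/(row_free _) -kermx_eq0 => k0.
pose v := nz_row (kermx (homogeneous_mx x)^T).
have v0 : v != 0 by rewrite nz_row_eq0.
have vX : v *m (homogeneous_mx x)^T = 0 by apply/sub_kermxP; exact: nz_row_sub.
exists (rsubmx v), (- v 0 (lshift d 0)); split.
  have [r0|] := eqVneq (rsubmx v) 0; last by left.
  right; rewrite oppr_eq0; apply: contra v0 => /eqP l0.
  apply/eqP/rowP => j; rewrite mxE; case: (split_ordP j) => k ->.
    by rewrite ord1.
  by move/rowP/(_ k): r0; rewrite !mxE.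
move=> i; apply/eqP; rewrite -addr_eq0 addrC -homogeneous_mx_mulT vX mxE.
by rewrite eqxx.
Qed.

(** A matrix with [#|A| <= d] rows cannot have rank [d + 1]. *)
Lemma exists_affine_zero_on n (x : 'I_n -> 'rV[R]_d) (A : {set 'I_n}) :
  (#|A| <= d)%N ->
  exists a b, (a != 0 \/ b != 0) /\ forall i, i \in A -> dotp a (x i) = b.
Proof.
move=> Ad; have [|a [b [ab0 H]]] := @exists_affine_zero #|A| (x \o enum_val).
  by rewrite /row_full neq_ltn ltnS (leq_trans (rank_leq_row _)).
exists a, b; split=> // i iA.
by rewrite -(enum_rankK_in iA iA); exact: H.
Qed.

Section GeneralPosition.
Context (x : 'I_d.+2 -> 'rV[R]_d) (hx : general_position x).

(** If [w j] were nonzero, an affine function vanishing at the points other than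
    [i0] and [j], of which there are [d], would also vanish at [j] because of
    the dependence [w], so [d.+1] points would lie on a hyperplane. *)
Lemma affine_independent (w : 'I_d.+2 -> R) i0 :
  w i0 = 0 -> \sum_i w i = 0 -> \sum_i w i *: x i = 0 -> forall i, w i = 0.
Proof.
move=> w0 sw swx j; apply/eqP/negPn/negP => wj.
have ji0 : j != i0 by apply: contra wj => /eqP ->; rewrite w0.
have cA : #|[set~ i0]%SET| = d.+1 by rewrite cardsC1 card_ord.
have [|a [b [ab H]]] := @exists_affine_zero_on _ x ([set~ i0]%SET :\ j).
  by move: cA; rewrite (cardsD1 j) !inE ji0 add1n => -[->].
case: hx => _ /(_ _ cA) + _; apply; exists a, b.
have Hi i : i != i0 -> dotp a (x i) = b.
  move=> ii0; have [->{i ii0}|ij] := eqVneq i j; last first.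
    by apply: H; rewrite !inE ij.
  have : \sum_i w i * (dotp a (x i) - b) = 0.
    under eq_bigr do rewrite mulrBr -dotpZr.
    by rewrite sumrB -dotp_sumr swx dotpC dotp0l -mulr_suml sw mul0r subrr.
  rewrite (bigD1 j)//= big1 ?addr0 => [|i ij].
    by move=> /eqP; rewrite mulf_eq0 (negPf wj)/= subr_eq0 => /eqP.
  have [->|ii0] := eqVneq i i0; first by rewrite w0 mul0r.
  by rewrite H ?subrr ?mulr0// !inE ij.
split; last by move=> i; rewrite !inE; exact: Hi.
case: ab => // b0; apply: contra b0 => /eqP a0.
by rewrite -(Hi _ ji0) a0 dotp0l.
Qed.

Lemma homogeneous_mx_full : row_full (homogeneous_mx x).
Proof.
apply/negPn/negP => /exists_affine_zero[a [b [ab H]]].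
have cA : #|[set~ (0 : 'I_d.+2)]%SET| = d.+1 by rewrite cardsC1 card_ord.
case: hx => _ /(_ _ cA) + _; apply; exists a, b; split=> //.
case: ab => // b0; apply: contra b0 => /eqP a0.
by rewrite -(H 0) a0 dotp0l.
Qed.

End GeneralPosition.

(** The dependence [lam] of the points, unique up to a factor, with weights
    [affine (al i) (ga i)] writing every point of the space as an affine
    combination. The frame is symmetric under [lam |-> - lam], so that every
    result about the indices with [0 < lam i] also holds for those with
    [lam i < 0]. *)
Record radon_frame (x : 'I_d.+2 -> 'rV[R]_d) (lam : 'I_d.+2 -> R)
    (al : 'I_d.+2 -> 'rV[R]_d) (ga : 'I_d.+2 -> R) : Prop := RadonFrame {
  frame_neq0 : forall i, lam i != 0;
  frame_sum : \sum_i lam i = 0;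
  frame_sumx : \sum_i lam i *: x i = 0;
  frame_unique : forall w, \sum_i w i = 0 -> \sum_i w i *: x i = 0 ->
    exists c, forall i, w i = c * lam i;
  frame_weight : forall z, \sum_i affine (al i) (ga i) z = 1;
  frame_weightx : forall z, \sum_i affine (al i) (ga i) z *: x i = z }.

(** The dependence spans the left kernel of the homogeneous matrix, and the
    weights come from a left inverse of this matrix, which has full column rank
    since the points do not all lie on a hyperplane. *)
Lemma exists_radon_frame x : general_position x ->
  exists lam al ga, radon_frame x lam al ga.
Proof.
move=> hx; pose X := homogeneous_mx x.
have k0 : kermx X != 0.
  rewrite -mxrank_eq0 mxrank_ker -lt0n subn_gt0.
  exact: leq_ltn_trans (rank_leq_col _) _.
pose lam := nz_row (kermx X).
have lX : lam *m X = 0 by apply/sub_kermxP; exact: nz_row_sub.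
have l0 : lam != 0 by rewrite nz_row_eq0.
have [sl slx] : \sum_i lam 0 i = 0 /\ \sum_i lam 0 i *: x i = 0.
  move: lX; rewrite mul_homogeneous_mx -row_mx0 => /eq_row_mx[+ ->].
  by move/matrixP/(_ 0 0); rewrite !mxE mulr1n.
have ln0 i : lam 0 i != 0.
  apply: contra l0 => /eqP li; apply/eqP/rowP => j; rewrite mxE.
  exact: (affine_independent hx (w := fun j => lam 0 j) li).
pose W := pinvmx X.
have WX : W *m X = 1%:M by apply: mulVpmx; exact: homogeneous_mx_full.
have EW z : \row_i affine (\row_k W (rshift 1 k) i) (W (lshift d 0) i) z =
    row_mx 1 z *m W.
  apply/rowP => i; rewrite [LHS]mxE [RHS]mxE big_split_ord big_ord1.
  rewrite /affine addrC; congr (_ + _).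
    by rewrite row_mxEl [X in X * _]mxE mul1r.
  by apply: eq_bigr => k _; rewrite row_mxEr mulrC; congr (_ * _); rewrite mxE.
have WE z : row_mx 1 z = row_mx 1 z *m W *m X by rewrite -mulmxA WX mulmx1.
exists (fun i => lam 0 i), (fun i => \row_k W (rshift 1 k) i),
  (fun i => W (lshift d 0) i); split => // [w sw swx|z|z].
- exists (w 0 / lam 0 0) => i; apply/eqP; rewrite -subr_eq0; apply/eqP.
  apply: (affine_independent hx (i0 := 0)
           (w := fun i => w i - w 0 / lam 0 0 * lam 0 i)).
  + by rewrite divfK// subrr.
  + by rewrite sumrB -mulr_sumr sl sw mulr0 subrr.
  + under eq_bigr do rewrite scalerBl -scalerA.
    by rewrite sumrB swx -scaler_sumr slx scaler0 subrr.
- move: (WE z); rewrite -EW mul_homogeneous_mx => /eq_row_mx[+ _].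
  move/esym/matrixP/(_ 0 0); rewrite mxE mulr1n [RHS]mxE => H.
  by apply: etrans H; apply: eq_bigr => i _; rewrite [RHS]mxE.
- move: (WE z); rewrite -EW mul_homogeneous_mx => /eq_row_mx[_ H].
  by rewrite [RHS]H; apply: eq_bigr => i _; rewrite [in RHS]mxE.
Qed.

Lemma radon_frame_opp x lam al ga : radon_frame x lam al ga ->
  radon_frame x (fun i => - lam i) al ga.
Proof.
case=> l0 sl slx un sw swx; split=> //.
- by move=> i; rewrite oppr_eq0.
- by rewrite sumrN sl oppr0.
- by under eq_bigr do rewrite scaleNr; rewrite sumrN slx oppr0.
- move=> w w0 wx; have [c H] := un w w0 wx.
  by exists (- c) => i; rewrite mulrNN.
Qed.

Lemma exists_pos x lam al ga : radon_frame x lam al ga -> exists i, 0 < lam i.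
Proof.
move=> F; apply: contrapT => np; have ln i : lam i < 0.
  rewrite lt_neqAle (frame_neq0 F) leNgt; apply/negP => li.
  by apply: np; exists i.
have : \sum_i lam i < 0.
  by rewrite big_ord_recl ltr_wnDr// sumr_le0// => i _; exact: ltW.
by rewrite (frame_sum F) ltxx.
Qed.

End Radon.

(** * Hulls, triangulations and interpolants in terms of weight ratios *)

Section Geometry.
Context {R : realType} {d : nat}.
Implicit Types (x : 'I_d.+2 -> 'rV[R]_d) (lam : 'I_d.+2 -> R)
  (al : 'I_d.+2 -> 'rV[R]_d) (ga : 'I_d.+2 -> R).

Definition slope lam al i : 'rV[R]_d := (lam i)^-1 *: al i.

(** The weight of [x i] divided by [lam i]. Changing the weights by a multiple
    [c] of [lam] shifts all ratios by [c]; so only differences of ratios are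
    intrinsic, and the vertices with zero weight are those whose ratio equals
    the shift. *)
Definition ratio lam al ga i := affine (slope lam al i) (ga i / lam i).

Section Envelope.
Variables (lam : 'I_d.+2 -> R) (al : 'I_d.+2 -> 'rV[R]_d) (ga : 'I_d.+2 -> R).
Variable i0 : 'I_d.+2.
Local Notation ratio := (ratio lam al ga).

(** The minimum of the ratios with [0 < lam i]. The default value of the
    iterated minimum is one of its terms as soon as [0 < lam i0]. *)
Definition envelope z :=
  \big[Order.min/ratio i0 z]_(i | 0 < lam i) ratio i z.

Lemma envelope_le i z : 0 < lam i -> envelope z <= ratio i z.
Proof. by move=> li; apply: bigmin_le_cond. Qed.

Lemma envelope_attained z : 0 < lam i0 ->
  exists2 i, 0 < lam i & envelope z = ratio i z.
Proof.
move=> l0; case: (@arg_minP _ _ _ i0 (fun i => 0 < lam i) (ratio^~ z) l0)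
  => i li H.
exists i => //; apply/le_anti; rewrite envelope_le//=.
by apply/bigmin_geP; split; [exact: H|].
Qed.

Lemma envelopeE i z : 0 < lam i0 -> 0 < lam i ->
  (forall k, 0 < lam k -> ratio i z <= ratio k z) -> envelope z = ratio i z.
Proof.
move=> l0 li H; have [k lk E] := envelope_attained z l0.
by apply/le_anti; rewrite envelope_le//= E H.
Qed.

Lemma continuous_envelope : continuous envelope.
Proof.
pose m r z := \big[Order.min/ratio i0 z]_(i <- r | 0 < lam i) ratio i z.
suff mc r : continuous (m r) by exact: mc.
elim: r => [|i r IH].
  rewrite (_ : m _ = ratio i0); first exact: continuous_affine.
  by apply/funext => y; rewrite /m big_nil.
have [li|li] := boolP (0 < lam i); last first.
  rewrite (_ : m _ = m r)//.
  by apply/funext => y; rewrite /m big_cons (negPf li).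
rewrite (_ : m _ = ratio i \min m r) => [z|]; last first.
  by apply/funext => y; rewrite /m big_cons li.
apply: continuous_min; [exact: continuous_affine|exact: IH].
Qed.

End Envelope.

Section Frame.
Variables (x : 'I_d.+2 -> 'rV[R]_d).
Variables (lam : 'I_d.+2 -> R) (al : 'I_d.+2 -> 'rV[R]_d) (ga : 'I_d.+2 -> R).
Hypothesis F : radon_frame x lam al ga.
Local Notation ratio := (ratio lam al ga).

Lemma mul_ratio i z : lam i * ratio i z = affine (al i) (ga i) z.
Proof.
rewrite /ratio /affine /slope dotpZl mulrDr mulrA mulfV ?(frame_neq0 F)//.
by rewrite mul1r mulrCA mulfV ?(frame_neq0 F)// mulr1.
Qed.

(** The weights of the frame at [z] and the given ones represent the same point,
    so they differ by a multiple of [lam]. *)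
Lemma conv_weights (A : {set 'I_d.+2}) (w : 'I_d.+2 -> R) :
  \sum_(i in A) w i = 1 -> exists c, forall i,
  lam i * (ratio i (\sum_(i in A) w i *: x i) - c) = if i \in A then w i else 0.
Proof.
move=> sw; set z := \sum_(i in A) _.
pose w' i := affine (al i) (ga i) z - if i \in A then w i else 0.
have [||c H] := frame_unique F (w := w').
- by rewrite sumrB (frame_weight F) -big_mkcond sw subrr.
- under eq_bigr do rewrite scalerBl.
  rewrite sumrB (frame_weightx F) /z big_mkcond.
  apply/eqP; rewrite subr_eq0; apply/eqP/eq_bigr => i _.
  by case: ifP; rewrite ?scale0r.
exists c => i; rewrite mulrBr mul_ratio [lam i * c]mulrC -H /w'; ring.
Qed.

(** The possible weights of [z] are [lam i * (ratio i z - c)] for a scalar [c]. *)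
Lemma conv_ratioP A z : conv x A z <->
  exists c, forall i, 0 <= lam i * (ratio i z - c) /\
    (i \notin A -> ratio i z = c).
Proof.
split=> [[w [w0 sw ->]]|[c H]].
  have [c H] := conv_weights sw; exists c => i; rewrite H.
  split=> [|iA]; first by case: ifP => // /w0.
  apply/eqP; rewrite -subr_eq0 -(mulrI_eq0 _ (lregP (frame_neq0 F i))) H.
  by rewrite (negPf iA).
pose w i := lam i * (ratio i z - c); have wA i : i \notin A -> w i = 0.
  by move=> iA; rewrite /w (H i).2// subrr mulr0.
have wE i : w i = affine (al i) (ga i) z - c * lam i.
  by rewrite /w mulrBr mul_ratio [c * _]mulrC.
exists w; split=> [i _||]; first exact: (H i).1.
  rewrite big_mkcond/= (eq_bigr w) => [|i _]; last by case: ifPn => // /wA.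
  under eq_bigr do rewrite wE.
  by rewrite sumrB (frame_weight F) -mulr_sumr (frame_sum F) mulr0 subr0.
rewrite big_mkcond/= (eq_bigr (fun i => w i *: x i)) => [|i _]; last first.
  by case: ifPn => // /wA ->; rewrite scale0r.
under eq_bigr do rewrite wE scalerBl -scalerA.
by rewrite sumrB (frame_weightx F) -scaler_sumr (frame_sumx F) scaler0 subr0.
Qed.

Lemma conv_le (A B : {set 'I_d.+2}) z : A \subset B -> conv x A z -> conv x B z.
Proof.
move=> /fintype.subsetP AB /conv_ratioP[c H]; apply/conv_ratioP; exists c => i.
split; first exact: (H i).1.
by move=> iB; apply: (H i).2; apply: contra iB; exact: AB.
Qed.

Lemma conv_setTP z : conv x [set: 'I_d.+2] z <->
  exists c, forall i, 0 <= lam i * (ratio i z - c).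
Proof.
split=> [/conv_ratioP[c H]|[c H]]; first by exists c => i; exact: (H i).1.
by apply/conv_ratioP; exists c => i; rewrite inE.
Qed.

(** The weight of the omitted vertex [i] is zero, so [c = ratio i z] in
    [conv_ratioP], and the other weights are nonnegative. *)
Lemma conv_facet i z : 0 < lam i -> conv x [set~ i]%SET z ->
  forall k, 0 < lam k -> ratio i z <= ratio k z.
Proof.
move=> li /conv_ratioP[c H] k lk; have [_ ->] := H i; last by rewrite !inE eqxx.
by have [] := H k; rewrite pmulr_rge0// subr_ge0.
Qed.

(** Separate the positive and the negative terms of the dependence and normalize
    both sums by the same factor. *)
Lemma exists_radon_point : exists p,
  conv x [set i | 0 < lam i]%SET p /\ conv x [set i | lam i < 0]%SET p.
Proof.
pose S := \sum_(i | 0 < lam i) lam i.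
have S0 : 0 < S.
  have [i li] := exists_pos F; rewrite /S (bigD1 i)//= ltr_wpDr// sumr_ge0//.
  by move=> k /andP[/ltW].
have notP i : (~~ (0 < lam i)) = (lam i < 0).
  by rewrite -leNgt le_eqVlt (negPf (frame_neq0 F i)).
have SN : \sum_(i | lam i < 0) lam i = - S.
  apply/eqP; rewrite -addr_eq0 addrC -(eq_bigl _ _ notP) /S.
  by rewrite -(bigID (fun i => 0 < lam i) xpredT) (frame_sum F).
exists (\sum_(i in [set i | 0 < lam i]%SET) (lam i / S) *: x i); split.
  exists (fun i => lam i / S); split=> // [i|].
    by rewrite inE => li; rewrite divr_ge0// ltW.
  under eq_bigl do rewrite inE.
  by rewrite -mulr_suml mulfV// gt_eqF.
exists (fun i => - (lam i / S)); split=> // [i||].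
- by rewrite inE => li; rewrite -mulNr divr_ge0 ?oppr_ge0// ltW.
- under eq_bigl do rewrite inE.
  by rewrite sumrN -mulr_suml SN mulNr opprK mulfV// gt_eqF.
under eq_bigl do rewrite inE; under [RHS]eq_bigl do rewrite inE.
under [RHS]eq_bigr do rewrite scaleNr.
apply/eqP; rewrite sumrN -subr_eq0 opprK -(eq_bigl _ _ notP).
rewrite -(bigID (fun i => 0 < lam i) xpredT)/=.
under eq_bigr do rewrite mulrC -scalerA.
by rewrite -scaler_sumr (frame_sumx F) scaler0.
Qed.

(** The Radon point [p] belongs to both simplices. If it were in the hull of
    their common vertices, all the ratios at [p] would be equal, and [p] would
    have weights that are all zero. *)
Lemma facet_signs i j : 0 < lam i -> lam j < 0 ->
  ~ (conv x [set~ i]%SET `&` conv x [set~ j]%SET =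
     conv x ([set~ i] :&: [set~ j])%SET).
Proof.
move=> li lj E; have [p [pP pN]] := exists_radon_point.
have : conv x ([set~ i] :&: [set~ j])%SET p.
  rewrite -E; split; [apply: conv_le pN|apply: conv_le pP];
    apply/fintype.subsetP => k;
    by rewrite !inE => lk; apply: contraTneq lk => ->; rewrite -leNgt ltW.
move=> /conv_ratioP[c H].
have [cP HP] := (conv_ratioP _ _).1 pP; have [cN HN] := (conv_ratioP _ _).1 pN.
have ec k : ratio k p = c.
  have eN : cN = c.
    by rewrite -(HN i).2 ?(H i).2// !inE ?eqxx// -leNgt ltW.
  have eP : cP = c.
    by rewrite -(HP j).2 ?(H j).2// !inE ?eqxx ?andbF// -leNgt ltW.
  have := frame_neq0 F k; rewrite neq_lt => /orP[lk|lk].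
    by rewrite (HP k).2// inE -leNgt ltW.
  by rewrite (HN k).2// inE -leNgt ltW.
have := frame_weight F p; under eq_bigr do rewrite -mul_ratio ec.
by rewrite -mulr_suml (frame_sum F) mul0r => /esym/eqP; rewrite oner_eq0.
Qed.

(** A simplex has [d.+1] of the [d.+2] points as vertices, so it omits one. *)
Lemma triangulation_signs t : is_triangulation x t ->
  (forall s, s \in t -> exists2 i, 0 < lam i & s = [set~ i]%SET) \/
  (forall s, s \in t -> exists2 i, lam i < 0 & s = [set~ i]%SET).
Proof.
move=> [cs _ It].
have sE s : s \in t -> exists i, s = [set~ i]%SET.
  move=> /cs[c _]; have /cards1P[i si] : #|~: s| == 1%N.
    by rewrite -(eqn_add2l #|s|) cardsC card_ord c addn1.
  by exists i; rewrite -si finset.setCK.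
have [[i [li it]]|nP] := pselect (exists i, 0 < lam i /\ [set~ i]%SET \in t).
  left=> s st; have [k sk] := sE s st; exists k => //.
  rewrite lt_neqAle eq_sym (frame_neq0 F)/= leNgt; apply/negP => lk.
  by apply: (facet_signs li lk); apply: It => //; rewrite -sk.
right=> s st; have [k sk] := sE s st; exists k => //.
rewrite lt_neqAle (frame_neq0 F)/= leNgt; apply/negP => lk.
by apply: nP; exists k; split=> //; rewrite -sk.
Qed.

Section LowerInterpolant.
Variable i0 : 'I_d.+2.
Hypothesis pos0 : 0 < lam i0.
Implicit Types Y : 'I_d.+2 -> R.

(** Zero exactly when the data [Y] are the values of an affine function. *)
Definition defect Y : R := \sum_k lam k * Y k.

(** Subtracting the envelope from all the ratios makes a weight vanish and the
    others nonnegative, that is, it yields the barycentric coordinates in one of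
    the simplices; this is the combination of the [Y k] with these coordinates. *)
Definition lower_interpolant Y z : R :=
  \sum_k Y k * affine (al k) (ga k) z - defect Y * envelope lam al ga i0 z.

Lemma lower_interpolant_attained Y z i :
  envelope lam al ga i0 z = ratio i z ->
  lower_interpolant Y z = affine
    (\sum_k Y k *: al k - defect Y *: slope lam al i)
    (\sum_k Y k * ga k - defect Y * (ga i / lam i)) z.
Proof.
rewrite /lower_interpolant => ->.
rewrite /ratio /affine dotpDl -[- (defect Y *: slope _ _ _)]scaleNr.
rewrite (dotpZl (- defect Y)) dotp_suml.
under eq_bigr do rewrite mulrDr -dotpZl.
rewrite big_split/=; ring.
Qed.

(** On the simplex that omits [i] the envelope is [ratio i], and shifting the
    weights by [ratio i z] makes them the barycentric coordinates of [z]. *)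
Lemma lower_interpolant_weights Y i (w : 'I_d.+2 -> R)
    (z := \sum_(k in [set~ i]%SET) w k *: x k) : 0 < lam i ->
  (forall k, k \in [set~ i]%SET -> 0 <= w k) ->
  \sum_(k in [set~ i]%SET) w k = 1 ->
  lower_interpolant Y z = \sum_(k in [set~ i]%SET) w k * Y k.
Proof.
move=> li w0 sw; have [c H] := conv_weights sw.
have ci : ratio i z = c.
  have := H i; rewrite !inE eqxx/= => /eqP; rewrite mulf_eq0.
  by rewrite (negPf (frame_neq0 F i))/= subr_eq0 => /eqP.
have cz : conv x [set~ i]%SET z by exists w.
rewrite /lower_interpolant (envelopeE pos0 li) ?ci; last first.
  by rewrite -ci; exact: conv_facet.
rewrite [RHS]big_mkcond/= mulr_suml -sumrB; apply: eq_bigr => k _.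
rewrite -mul_ratio.
transitivity (lam k * (ratio k z - c) * Y k); first by ring.
by rewrite H; case: ifP; rewrite ?mul0r.
Qed.

Section LowerTriangulation.
Variables (t : {set {set 'I_d.+2}}).
Hypothesis ht : is_triangulation x t.
Hypothesis t_pos :
  forall s, s \in t -> exists2 i, 0 < lam i & s = [set~ i]%SET.

(** The interpolant is chosen among the functions with the required properties,
    so one of them has to be exhibited. *)
Lemma exists_interpolant Y : is_interpolant x t Y
  (patch (fun=> 0) (conv x [set: 'I_d.+2]) (lower_interpolant Y)).
Proof.
set f := patch _ _ _.
have fE z : conv x [set: 'I_d.+2] z -> f z = lower_interpolant Y z.
  by move=> cz; rewrite /f patchE mem_set.
split.
- apply: (@subspace_eq_continuous _ _ _ (lower_interpolant Y))
    => [z /set_mem cz|].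
    exact: (esym (fE _ cz)).
  apply: continuous_subspaceT => z.
  apply: (@continuousB _ _ _ (fun z => \sum_k Y k * affine (al k) (ga k) z)
    (fun z => defect Y * envelope lam al ga i0 z)).
    apply: (continuous_big (op := +%R)) => [|k _ y].
      exact: add_continuous.
    by apply: continuousM; [exact: cst_continuous|exact: continuous_affine].
  by apply: continuousM; [exact: cst_continuous|exact: continuous_envelope].
- move=> s /t_pos[i li ->].
  exists (\sum_k Y k *: al k - defect Y *: slope lam al i),
    (\sum_k Y k * ga k - defect Y * (ga i / lam i)) => z cz.
  rewrite fE; last by apply: conv_le cz; exact: finset.subsetT.
  apply: lower_interpolant_attained; apply: envelopeE => // k lk.
  exact: conv_facet.
- move=> s k /t_pos[i li ->] ki.
  pose w j : R := (j == k)%:R.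
  have xk : x k = \sum_(j in [set~ i]%SET) w j *: x j.
    rewrite (bigD1 k)//= /w eqxx scale1r big1 ?addr0// => j /andP[_ /negPf ->].
    by rewrite scale0r.
  have w0 j : j \in [set~ i]%SET -> 0 <= w j by rewrite ler0n.
  have sw : \sum_(j in [set~ i]%SET) w j = 1.
    by rewrite (bigD1 k)//= /w eqxx big1 ?addr0// => j /andP[_ /negPf ->].
  have cx : conv x [set: 'I_d.+2] (x k).
    by apply: (@conv_le [set~ i]%SET); [exact: finset.subsetT|exists w].
  rewrite fE// xk lower_interpolant_weights//.
  rewrite (bigD1 k)//= /w eqxx mul1r big1 ?addr0// => j /andP[_ /negPf ->].
  by rewrite mul0r.
- by move=> z cz; rewrite /f patchE memNset.
Qed.

(** Barycentric coordinates in any simplex of the triangulation that contains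
    [z] determine the value at [z]. *)
Lemma interpolantE Y z : conv x [set: 'I_d.+2] z ->
  interpolant x t Y z = lower_interpolant Y z.
Proof.
move=> cz; have : is_interpolant x t Y (interpolant x t Y).
  exact: xgetI (exists_interpolant Y).
set f := interpolant x t Y => -[_ f_aff f_vert _].
have [_ cover _] := ht; have [s st] : (\bigcup_(s in [set` t]) conv x s) z.
  by rewrite cover.
have [i li si] := t_pos st; rewrite si => -[w [w0 sw zE]].
have [a [b fab]] := f_aff _ st.
rewrite zE lower_interpolant_weights// fab; last by rewrite si; exists w.
rewrite -/(affine a b _) affine_comb//; apply: eq_bigr => k ki; congr (_ * _).
have ks : k \in s by rewrite si.
rewrite -(f_vert _ _ st ks) -/(affine a b _) fab//.
exists (fun j => (j == k)%:R); split=> [j _||]; first by rewrite ler0n.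
  by rewrite (bigD1 k)//= eqxx big1 ?addr0// => j /andP[_ /negPf ->].
rewrite (bigD1 k)//= eqxx scale1r big1 ?addr0// => j /andP[_ /negPf ->].
by rewrite scale0r.
Qed.

End LowerTriangulation.
End LowerInterpolant.

(** The interior of the intersection of the simplex that omits [i] with the one
    that omits [j]: both interpolants are affine there. *)
Definition chamber i j : set 'rV[R]_d := [set z | [/\ 0 < lam i, lam j < 0,
  forall k, 0 < lam k -> k != i -> ratio i z < ratio k z,
  forall k, lam k < 0 -> k != j -> ratio k z < ratio j z
  & ratio j z < ratio i z]].

Definition wall : set 'rV[R]_d :=
  [set z | exists i k, i != k /\ ratio i z = ratio k z].

Lemma chamber_min i j z : chamber i j z ->
  forall k, 0 < lam k -> ratio i z <= ratio k z.
Proof.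
move=> [_ _ H _ _] k lk; have [->//|ki] := eqVneq k i; exact/ltW/H.
Qed.

Lemma chamber_max i j z : chamber i j z ->
  forall k, lam k < 0 -> ratio k z <= ratio j z.
Proof.
move=> [_ _ _ H _] k lk; have [->//|ki] := eqVneq k j; exact/ltW/H.
Qed.

Lemma chamber_conv i j z : chamber i j z -> conv x [set: 'I_d.+2] z.
Proof.
move=> cz; apply/conv_setTP; exists (ratio i z) => k.
have := frame_neq0 F k; rewrite neq_lt => /orP[lk|lk].
  rewrite nmulr_rge0// subr_le0 (le_trans (chamber_max cz lk))// ltW//.
  by case: cz.
by rewrite pmulr_rge0// subr_ge0 (chamber_min cz).
Qed.

(** Off the walls the ratios at [z] are pairwise distinct, so the minimum and
    the maximum are attained once; a scalar [c] as in [conv_setTP] lies between. *)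
Lemma conv_chamber z : conv x [set: 'I_d.+2] z -> ~ wall z ->
  exists i j, chamber i j z.
Proof.
move=> /conv_setTP[c H] nw.
have [i0 p0] := exists_pos F.
have [j0] := exists_pos (radon_frame_opp F); rewrite oppr_gt0 => n0.
case: (@arg_minP _ _ _ i0 (fun i => 0 < lam i) (ratio^~ z) p0) => i li Hi.
case: (@arg_maxP _ _ _ j0 (fun i => lam i < 0) (ratio^~ z) n0) => j lj Hj.
have {}Hj k : lam k < 0 -> ratio k z <= ratio j z by exact: Hj.
have ne k l : k != l -> ratio k z != ratio l z.
  by move=> kl; apply/eqP => e; apply: nw; exists k, l.
exists i, j; split=> // [k lk ki|k lk ki|].
- by rewrite lt_neqAle Hi// andbT ne// eq_sym.
- by rewrite lt_neqAle Hj// andbT ne.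
rewrite lt_neqAle ne; last by apply: contraTneq li => <-; rewrite -leNgt ltW.
apply: (@le_trans _ _ c).
  by have := H j; rewrite nmulr_rge0// subr_le0.
by have := H i; rewrite pmulr_rge0// subr_ge0.
Qed.

Lemma chamber_inj i j i' j' z : chamber i j z -> chamber i' j' z ->
  i = i' /\ j = j'.
Proof.
move=> c c'; have [li lj Hi Hj _] := c; have [li' lj' Hi' Hj' _] := c'.
split; apply/eqP/negPn/negP => ne.
  have := Hi _ li'; rewrite eq_sym ne => /(_ isT); apply/negP.
  by rewrite -leNgt (chamber_min c').
have := Hj _ lj'; rewrite eq_sym ne => /(_ isT); apply/negP.
by rewrite -leNgt (chamber_max c').
Qed.

Lemma chamber_near i j z : chamber i j z -> \forall y \near z, chamber i j y.
Proof.
move=> [li lj Hi Hj Hij].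
have nP : \forall y \near z,
    forall k, 0 < lam k -> k != i -> ratio i y < ratio k y.
  apply: (@filter_forall _ _
    (fun k y => 0 < lam k -> k != i -> ratio i y < ratio k y)
    (nbhs z)) => k.
  have [lk|lk] := boolP (0 < lam k); last by near=> y.
  have [->|ki] := eqVneq k i; first by near=> y.
  by have := near_affine_lt (Hi k lk ki); apply: filterS.
have nN : \forall y \near z,
    forall k, lam k < 0 -> k != j -> ratio k y < ratio j y.
  apply: (@filter_forall _ _
    (fun k y => lam k < 0 -> k != j -> ratio k y < ratio j y)
    (nbhs z)) => k.
  have [lk|lk] := boolP (lam k < 0); last by near=> y.
  have [->|ki] := eqVneq k j; first by near=> y.
  by have := near_affine_lt (Hj k lk ki); apply: filterS.
have nji := near_affine_lt Hij.
near=> y; split=> //.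
- by near: y; exact: nP.
- by near: y; exact: nN.
- by near: y; exact: nji.
Unshelve. all: by end_near. Qed.

Lemma grad_interpolant i0 t Y i j z : 0 < lam i0 -> is_triangulation x t ->
  (forall s, s \in t -> exists2 i, 0 < lam i & s = [set~ i]%SET) ->
  chamber i j z ->
  grad (interpolant x t Y) z = \sum_k Y k *: al k - defect Y *: slope lam al i.
Proof.
move=> p0 ht tp /chamber_near cz.
apply: (@grad_near_affine _ _ _ _
  (\sum_k Y k * ga k - defect Y * (ga i / lam i))).
near=> y; have cy : chamber i j y by near: y.
rewrite (interpolantE p0 ht tp); last exact: chamber_conv cy.
apply: lower_interpolant_attained; apply: envelopeE => //; first by case: cy.
exact: chamber_min cy.
Unshelve. all: by end_near. Qed.

End Frame.
End Geometry.

(** * Chambers are measurable and bounded, walls are null *)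

Section Chambers.
Context {R : realType} {d : nat}.
Notation T := (measurableTypeR R).
Notation P := (@rV_of_tuple R d).

Lemma affine_tuple b c (u : d.-tuple T) :
  affine b c (P u) = \sum_i b 0 i * tnth u i + c.
Proof. by congr (_ + _); apply: eq_bigr => i _; rewrite mxE. Qed.

Lemma measurable_affine_tuple b c :
  measurable_fun setT (fun u : d.-tuple T => affine b c (P u)).
Proof.
by under eq_fun do rewrite affine_tuple; exact: measurable_affine.
Qed.

Variables (x : 'I_d.+2 -> 'rV[R]_d).
Variables (lam : 'I_d.+2 -> R) (al : 'I_d.+2 -> 'rV[R]_d) (ga : 'I_d.+2 -> R).

Lemma measurable_chamber i j : measurable (P @^-1` chamber lam al ga i j).
Proof.
have [li|li] := boolP (0 < lam i); last first.
  rewrite (_ : _ @^-1` _ = set0)//; apply/seteqP.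
  by split=> u // -[]; rewrite (negPf li).
have [lj|lj] := boolP (lam j < 0); last first.
  rewrite (_ : _ @^-1` _ = set0)//; apply/seteqP.
  by split=> u // -[_]; rewrite (negPf lj).
pose r k u := ratio lam al ga k (P u).
have mr k : measurable_fun setT (r k) by exact: measurable_affine_tuple.
rewrite (_ : _ @^-1` _ =
    [set u | forall k, 0 < lam k -> k != i -> r i u < r k u] `&`
    [set u | forall k, lam k < 0 -> k != j -> r k u < r j u] `&`
    [set u | r j u < r i u]).
  apply: measurableI; last exact: measurable_set_lt.
  by apply: measurableI; apply: measurable_forall => k;
    do 2 apply: measurable_imply;
    exact: measurable_set_lt.
by apply/seteqP; split=> u; [case|case=> -[]; split].
Qed.

Lemma measurable_envelope i0 :
  measurable_fun setT (fun u : d.-tuple T => envelope lam al ga i0 (P u)).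
Proof.
pose m r u := \big[Order.min/ratio lam al ga i0 (P u)]_(i <- r | 0 < lam i)
  ratio lam al ga i (P u).
suff mc r : measurable_fun setT (m r) by exact: mc.
elim: r => [|i r IH].
  rewrite (_ : m _ = fun u => ratio lam al ga i0 (P u)).
    exact: measurable_affine_tuple.
  by apply/funext => y; rewrite /m big_nil.
have [li|li] := boolP (0 < lam i); last first.
  rewrite (_ : m _ = m r)//.
  by apply/funext => y; rewrite /m big_cons (negPf li).
rewrite (_ : m _ = (fun u => ratio lam al ga i (P u)) \min m r); last first.
  by apply/funext => y; rewrite /m big_cons li.
apply: measurable_minr => //; exact: measurable_affine_tuple.
Qed.

Lemma conv_box : exists B, forall u, conv x [set: 'I_d.+2] (P u) -> box B u.
Proof.
exists (\sum_i \sum_k `|x i 0 k|) => u [w [w0 sw uE]] k.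
rewrite /= in_itv/= -ler_norml.
have -> : tnth u k = (P u) 0 k by rewrite mxE.
rewrite uE summxE (le_trans (ler_norm_sum _ _ _))//.
rewrite big_mkcond/= ler_sum// => i _; rewrite inE mxE normrM.
have w1 : `|w i| <= 1.
  have w0' j : 0 <= w j by apply: w0; rewrite inE.
  by rewrite ger0_norm// -sw (bigD1 i) ?inE//= lerDl sumr_ge0.
apply: (@le_trans _ _ `|x i 0 k|); first by rewrite ler_piMl.
by rewrite (bigD1 k)//= lerDl sumr_ge0.
Qed.

Section Frame.
Hypothesis F : radon_frame x lam al ga.

Definition volume i j : R :=
  fine (lebesgue_tuple d (P @^-1` chamber lam al ga i j)).

Lemma chamber_lty i j :
  (lebesgue_tuple d (P @^-1` chamber lam al ga i j) < +oo)%E.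
Proof.
have [B cB] := conv_box; apply: le_lt_trans (lebesgue_tuple_box_lty d B).
apply: le_measure; rewrite ?inE.
- exact: measurable_chamber.
- exact: measurable_box.
by move=> u /= cu; apply: cB; exact: chamber_conv cu.
Qed.

Lemma vertex_ratio j : exists c, forall k,
  lam k * (ratio lam al ga k (x j) - c) = (k == j)%:R.
Proof.
have [|c] := conv_weights F (A := [set j]%SET) (w := fun=> 1).
  by rewrite big_set1.
rewrite big_set1 scale1r => H; exists c => k; rewrite H inE.
by case: eqP.
Qed.

(** At a vertex other than [x i] and [x k] the two ratios agree, whereas at
    [x i] they do not; so their difference is not constant. The third vertex
    exists because the injectivity of [x] forces [0 < d]. *)
Lemma slope_neq i k : injective x -> i != k -> slope lam al i != slope lam al k.
Proof.
move=> xinj ik; have [j [ji jk]] : exists j, j != i /\ j != k.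
  have d0 : (0 < d)%N.
    rewrite lt0n; apply: (contraNneq _ ik) => d0; apply/eqP/xinj/rowP => l.
    by have := ltn_ord l; rewrite [X in (_ < X)%N]d0.
  have /card_gt0P[j] : (0 < #|~: [set i; k]%SET|)%N.
    by rewrite cardsCs finset.setCK card_ord cards2 ik subn_gt0 !ltnS.
  by rewrite !inE negb_or => /andP[]; exists j.
have same c y l m
    (H : forall k, lam k * (ratio lam al ga k y - c) = (k == l)%:R) :
    m != l -> ratio lam al ga m y = c.
  move=> ml; have := H m; rewrite (negPf ml) => /eqP; rewrite mulf_eq0.
  by rewrite (negPf (frame_neq0 F m))/= subr_eq0 => /eqP.
have [c Hj] := vertex_ratio j; have [c' Hi] := vertex_ratio i.
apply/eqP => ss.
have Ej : ratio lam al ga i (x j) = ratio lam al ga k (x j).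
  by rewrite !(same _ _ _ _ Hj)// eq_sym.
have Ei : ratio lam al ga i (x i) = ratio lam al ga k (x i).
  by move: Ej; rewrite /ratio /affine ss => /addrI ->.
have := Hi i; rewrite eqxx Ei (same _ _ _ _ Hi) 1?eq_sym// subrr mulr0.
by move=> /esym/eqP; rewrite oner_eq0.
Qed.

(** A wall lies in the union of the hyperplanes on which two ratios agree. *)
Lemma wall_null : injective x -> exists N : set (d.-tuple T),
  [/\ measurable N, lebesgue_tuple d N = 0%E &
      forall u, wall lam al ga (P u) -> N u].
Proof.
move=> xinj; pose H (p : 'I_d.+2 * 'I_d.+2) : set (d.-tuple T) :=
  [set u | ratio lam al ga p.1 (P u) = ratio lam al ga p.2 (P u)].
have HE p : H p = [set u |
    \sum_i (slope lam al p.1 - slope lam al p.2) 0 i * tnth u i +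
      (ga p.1 / lam p.1 - ga p.2 / lam p.2) = 0].
  apply/seteqP; split=> u;
    rewrite /H /= -affine_tuple /ratio /affine dotpDl dotpNl.
    by move=> E; apply/eqP; rewrite addrACA -opprD E subrr.
  by rewrite addrACA -opprD => /eqP; rewrite subr_eq0 => /eqP.
have mH p : measurable (H p).
  rewrite HE -[X in measurable X]setTI.
  exact: (measurable_affine _ _ measurableT (measurable_set1 0)).
have H0 p : p.1 != p.2 -> lebesgue_tuple d (H p) = 0%E.
  move=> /(slope_neq xinj); rewrite -subr_eq0 => /rV0Pn[i si].
  rewrite HE; exact: lebesgue_tuple_hyperplane si.
exists (\big[setU/set0]_(p | p.1 != p.2) H p).
have [mN N0] : measurable (\big[setU/set0]_(p | p.1 != p.2) H p) /\
    lebesgue_tuple d (\big[setU/set0]_(p | p.1 != p.2) H p) = 0%E.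
  apply: (big_ind (fun A => measurable A /\ lebesgue_tuple d A = 0%E)) => //.
    move=> A B [mA A0] [mB B0]; split; first exact: measurableU.
    exact: null_set_setU.
  by move=> p p12; split=> //; exact: H0.
split=> // u [i [k [ik E]]].
rewrite -bigcup_seq_cond; exists (i, k) => //=.
by rewrite mem_index_enum.
Qed.

End Frame.
End Chambers.

(** * The fibre length and the integral of its derivative *)

Section Opposite.
Context {R : realType} {d : nat}.
Variables (lam : 'I_d.+2 -> R) (al : 'I_d.+2 -> 'rV[R]_d) (ga : 'I_d.+2 -> R).
Local Notation nlam := (fun i => - lam i).

Lemma slope_opp i : slope nlam al i = - slope lam al i.
Proof. by rewrite /slope invrN scaleNr. Qed.

Lemma ratio_opp i z : ratio nlam al ga i z = - ratio lam al ga i z.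
Proof. by rewrite /ratio /affine slope_opp dotpNl invrN mulrN opprD. Qed.

Lemma chamber_opp i j : chamber nlam al ga j i = chamber lam al ga i j.
Proof.
apply/seteqP; split=> z [].
- rewrite oppr_gt0 oppr_lt0 !ratio_opp ltrN2 => lj li Hj Hi ij.
  split=> // k lk kn.
    by have := Hi k; rewrite !ratio_opp ltrN2 oppr_lt0; exact.
  by have := Hj k; rewrite !ratio_opp ltrN2 oppr_gt0; exact.
move=> li lj Hi Hj ij.
split; rewrite ?oppr_gt0 ?oppr_lt0 ?ratio_opp ?ltrN2// => k.
  by rewrite oppr_gt0 !ratio_opp ltrN2; exact: Hj.
by rewrite oppr_lt0 !ratio_opp ltrN2; exact: Hi.
Qed.

End Opposite.

Section FibreLength.
Context {R : realType} {d : nat}.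
Notation T := (measurableTypeR R).
Notation P := (@rV_of_tuple R d).
Variables (x : 'I_d.+2 -> 'rV[R]_d).

(** A common bound for the variation of all the ratios under a translation by
    [v]. *)
Definition variation (lam : 'I_d.+2 -> R) (al : 'I_d.+2 -> 'rV[R]_d) v : R :=
  \sum_i `|dotp (slope lam al i) v|.

Lemma variationZ lam al (c : R) v : 0 <= c ->
  variation lam al (c *: v) = c * variation lam al v.
Proof.
move=> c0; rewrite /variation mulr_sumr; apply: eq_bigr => i _.
by rewrite dotpZr normrM ger0_norm.
Qed.

Lemma variation_opp lam al v :
  variation (fun i => - lam i) al v = variation lam al v.
Proof. by apply: eq_bigr => i _; rewrite slope_opp dotpNl normrN. Qed.

Lemma le_envelopeD lam al ga i0 z v : 0 < lam i0 ->
  envelope lam al ga i0 (z + v) <= envelope lam al ga i0 z + variation lam al v.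
Proof.
move=> l0; have [i li ->] := envelope_attained al ga z l0.
rewrite (le_trans (envelope_le _ _ _ _ li))// /ratio affineD lerD2l.
rewrite (le_trans (ler_norm _))// /variation (bigD1 i)//= lerDl.
by rewrite sumr_ge0.
Qed.

Lemma envelope_lipschitz lam al ga i0 z v : 0 < lam i0 ->
  `|envelope lam al ga i0 (z + v) - envelope lam al ga i0 z|
    <= variation lam al v.
Proof.
move=> l0; have := @le_envelopeD lam al ga i0 z v l0.
have := @le_envelopeD lam al ga i0 (z + v) (- v) l0.
have -> : variation lam al (- v) = variation lam al v.
  by apply: eq_bigr => i _; rewrite dotpC dotpNl normrN dotpC.
by rewrite addrK ler_norml; move=> h1 h2; apply/andP; split; lra.
Qed.

Variables (lam : 'I_d.+2 -> R) (al : 'I_d.+2 -> 'rV[R]_d) (ga : 'I_d.+2 -> R).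
Hypothesis F : radon_frame x lam al ga.
Local Notation nlam := (fun i => - lam i).
Variables i0 j0 : 'I_d.+2.
Hypothesis pos0 : 0 < lam i0.
Hypothesis neg0 : 0 < nlam j0.

(** The minimum of the ratios with [0 < lam i] minus the maximum of those with
    [lam i < 0]: the envelope for [- lam] is the opposite of that maximum. *)
Definition gap z : R := envelope lam al ga i0 z + envelope nlam al ga j0 z.
(** The length of the segment of all [c] that represent [z] as a convex
    combination, that is, of the fibre over [z] when the hull is seen as a
    projection of a simplex of dimension [d.+1]. *)
Definition fibre_length z : R := Order.max 0 (gap z).

Lemma fibre_length_ge0 z : 0 <= fibre_length z.
Proof. by rewrite /fibre_length le_max lexx. Qed.

Lemma fibre_length_lipschitz z v :
  `|fibre_length (z + v) - fibre_length z| <= variation lam al v *+ 2.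
Proof.
have max_lip (a b : R) : `|Order.max 0 a - Order.max 0 b| <= `|a - b|.
  by case: (leP 0 a) => ?; case: (leP 0 b) => ?; rewrite ?subrr ?normr0//;
    rewrite ler_norml ?subr0 ?sub0r; apply/andP;
    have := ler_norm (a - b); have := ler_norm (b - a);
    rewrite (distrC b a); split; lra.
rewrite (le_trans (max_lip _ _))// /gap opprD addrACA.
rewrite (le_trans (ler_normD _ _))//.
rewrite mulr2n lerD//; first exact: envelope_lipschitz.
by rewrite -(variation_opp lam al); exact: envelope_lipschitz.
Qed.

(** The value of the envelope at [z] serves as the scalar [c] of [conv_setTP]. *)
Lemma gap_conv z : 0 <= gap z -> conv x [set: 'I_d.+2] z.
Proof.
rewrite /gap => h; apply/(conv_setTP F); exists (envelope lam al ga i0 z) => k.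
have := frame_neq0 F k; rewrite neq_lt => /orP[lk|lk].
  have := @envelope_le _ _ nlam al ga j0 k z; rewrite oppr_gt0 => /(_ lk).
  by rewrite ratio_opp nmulr_rge0// => ?; lra.
have := @envelope_le _ _ lam al ga i0 k z lk.
by rewrite pmulr_rge0// => ?; lra.
Qed.

Lemma fibre_length_outside z : ~ conv x [set: 'I_d.+2] z -> fibre_length z = 0.
Proof.
move=> nz; apply/max_idPl; rewrite leNgt; apply/negP => h.
by apply/nz/gap_conv/ltW.
Qed.

Lemma fibre_length_chamber i j z : chamber lam al ga i j z ->
  fibre_length z = ratio lam al ga i z - ratio lam al ga j z.
Proof.
move=> c; have [li lj _ _ ij] := c.
rewrite /fibre_length /gap (envelopeE pos0 li (chamber_min c)).
rewrite (envelopeE neg0 (i := j)) ?oppr_gt0// => [|k]; last first.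
  by rewrite oppr_gt0 !ratio_opp lerN2; exact: chamber_max c k.
by rewrite ratio_opp; apply/max_idPr; rewrite subr_ge0 ltW.
Qed.

Lemma fibre_length_le z :
  fibre_length z <= `|ratio lam al ga i0 z - ratio lam al ga j0 z|.
Proof.
rewrite /fibre_length ge_max normr_ge0/= (le_trans _ (ler_norm _))// /gap.
rewrite lerD ?envelope_le//.
by rewrite (le_trans (envelope_le _ _ _ _ neg0))// ratio_opp.
Qed.

Lemma continuous_gap : continuous gap.
Proof.
move=> z; apply: (@continuousD _ _ _
    (envelope lam al ga i0) (envelope nlam al ga j0));
  exact: continuous_envelope.
Qed.

Lemma measurable_fibre_length :
  measurable_fun setT (fun u : d.-tuple T => fibre_length (P u)).
Proof.
apply: (@measurable_maxr _ _ _ _ (fun=> 0) (fun u => gap (P u))).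
  exact: measurable_cst.
by apply: (@measurable_funD _ _ _ _ (fun u => envelope lam al ga i0 (P u))
  (fun u => envelope nlam al ga j0 (P u))); exact: measurable_envelope.
Qed.

Lemma affine_box b c B (u : d.-tuple T) : box B u ->
  `|affine b c (P u)| <= \sum_i `|b 0 i| * B + `|c|.
Proof.
move=> Bu; rewrite (le_trans (ler_normD _ _))// lerD2r.
rewrite (le_trans (ler_norm_sum _ _ _))// ler_sum// => i _.
rewrite normrM ler_wpM2l// mxE ler_norml.
by have := Bu i; rewrite /= in_itv.
Qed.

(** It is bounded by an affine function on a box that contains the hull, and it
    vanishes outside this box. *)
Lemma integrable_fibre_length :
  (lebesgue_tuple d).-integrable setT (fun u => (fibre_length (P u))%:E).
Proof.
have [B cB] := conv_box x.
pose b := slope lam al i0 - slope lam al j0.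
pose c := ga i0 / lam i0 - ga j0 / lam j0.
pose M := \sum_i `|b 0 i| * B + `|c|.
apply: (@le_integrable _ _ _ _ _ measurableT _
  (fun u => (M * \1_(box B) u)%:E)).
- by apply/measurable_EFinP; exact: measurable_fibre_length.
- move=> u _; rewrite lee_fin ger0_norm ?fibre_length_ge0//.
  have [uB|uB] := pselect (conv x [set: 'I_d.+2] (P u)); last first.
    by rewrite fibre_length_outside.
  rewrite indicE mem_set; last exact: cB.
  rewrite mulr1 (le_trans (fibre_length_le _))// (le_trans _ (ler_norm _))//.
  rewrite (_ : _ - _ = affine b c (P u)); first exact/affine_box/cB.
  by rewrite /ratio /affine /b /c dotpDl dotpNl; ring.
- apply: integrable_scaled_indic; first exact: measurable_box.
  exact: lebesgue_tuple_box_lty.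
Qed.

Section Direction.
Variable a : 'rV[R]_d.

Definition tuple_scale (e : R) : d.-tuple T := [tuple (e * a 0 i : T) | i < d].

Lemma addt_scale e u : P (addt (tuple_scale e) u) = P u + e *: a.
Proof. by apply/rowP => i; rewrite !mxE tnth_addt tnth_mktuple. Qed.

Definition diff_quot (n : nat) (u : d.-tuple T) : R :=
  n.+1%:R * (fibre_length (P u + n.+1%:R^-1 *: a) - fibre_length (P u)).

Lemma measurable_fibre_length_translate e :
  measurable_fun setT (fun u : d.-tuple T => fibre_length (P u + e *: a)).
Proof.
rewrite (_ : (fun u => _) =
    (fun u => fibre_length (P u)) \o addt (tuple_scale e)).
  apply: measurableT_comp; last exact: measurable_addt.
  exact: measurable_fibre_length.
by apply/funext => u /=; rewrite addt_scale.
Qed.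

Lemma integral_fibre_length_translate e :
  (\int[lebesgue_tuple d]_u (fibre_length (P u + e *: a))%:E =
   \int[lebesgue_tuple d]_u (fibre_length (P u))%:E)%E.
Proof.
rewrite -[RHS](ge0_integral_translate (tuple_scale e)).
- by apply: eq_integral => u _; rewrite addt_scale.
- by apply/measurable_EFinP; exact: measurable_fibre_length.
- by move=> u; rewrite lee_fin fibre_length_ge0.
Qed.

Lemma integrable_fibre_length_translate e :
  (lebesgue_tuple d).-integrable setT
    (fun u => (fibre_length (P u + e *: a))%:E).
Proof.
apply/integrableP; split.
  by apply/measurable_EFinP; exact: measurable_fibre_length_translate.
rewrite (eq_integral (fun u => (fibre_length (P u + e *: a))%:E)); last first.
  by move=> u _; rewrite gee0_abs// lee_fin fibre_length_ge0.
rewrite integral_fibre_length_translate.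
have /integrableP[_] := integrable_fibre_length.
rewrite (eq_integral (fun u => (fibre_length (P u))%:E))// => u _.
by rewrite gee0_abs// lee_fin fibre_length_ge0.
Qed.

(** Translation invariance: the two translates of the fibre length have the same
    finite integral. *)
Lemma integral_diff_quot n :
  (\int[lebesgue_tuple d]_u (diff_quot n u)%:E = 0)%E.
Proof.
rewrite /diff_quot; under eq_integral do rewrite EFinM EFinB.
rewrite integralZl//; last first.
  apply: integrableB => //; last exact: integrable_fibre_length.
  exact: integrable_fibre_length_translate.
rewrite integralB_EFin//; last 2 first.
- exact: integrable_fibre_length_translate.
- exact: integrable_fibre_length.
rewrite integral_fibre_length_translate subee ?mule0//.
by apply: integrable_fin_num => //; exact: integrable_fibre_length.
Qed.

Lemma measurable_diff_quot n : measurable_fun setT (diff_quot n).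
Proof.
apply: measurable_funM; first exact: measurable_cst.
apply: measurable_funB; last exact: measurable_fibre_length.
exact: measurable_fibre_length_translate.
Qed.

Lemma diff_quot_bound n u : `|diff_quot n u| <= variation lam al a *+ 2.
Proof.
rewrite /diff_quot normrM ger0_norm// mulrC -ler_pdivlMr//.
rewrite (le_trans (fibre_length_lipschitz _ _))// variationZ//.
by rewrite mulrC mulrnAl.
Qed.

Lemma diff_quot_support :
  exists B, forall n u, ~ box B u -> diff_quot n u = 0.
Proof.
(* The steps are at most [1], so a translate of the hull by a multiple of [a]
   stays in a box enlarged by the coordinates of [a]. *)
have [B cB] := conv_box x; exists (B + \sum_i `|a 0 i|) => n u nu.
suff [h1 h2] : fibre_length (P u) = 0 /\
    fibre_length (P u + n.+1%:R^-1 *: a) = 0.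
  by rewrite /diff_quot h1 h2 subrr mulr0.
have ai i : `|a 0 i| <= \sum_i `|a 0 i|.
  by rewrite (bigD1 i)//= lerDl sumr_ge0.
split; apply: fibre_length_outside; [|rewrite -addt_scale];
  move=> /cB Bu; apply: nu => i;
  have := Bu i; rewrite /= !in_itv/= -!ler_norml.
  by move=> h; rewrite (le_trans h)// lerDl sumr_ge0.
rewrite tnth_addt tnth_mktuple => h.
rewrite -(addrK (n.+1%:R^-1 * a 0 i) (tnth u i)) (le_trans (ler_normB _ _))//.
rewrite lerD// normrM (le_trans _ (ai i))// ler_piMl// ger0_norm//.
by rewrite invf_le1// ler1n.
Qed.

Definition fibre_derivative (u : d.-tuple T) : R :=
  \sum_p dotp (slope lam al p.1 - slope lam al p.2) a *
    \1_(P @^-1` chamber lam al ga p.1 p.2) u.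

Lemma fibre_derivativeE i j u : chamber lam al ga i j (P u) ->
  fibre_derivative u = dotp (slope lam al i - slope lam al j) a.
Proof.
move=> c; rewrite /fibre_derivative (bigD1 (i, j))//=.
rewrite indicE mem_set// mulr1.
rewrite big1 ?addr0// => -[k l] /= kl; rewrite indicE memNset ?mulr0// => c'.
by case: (chamber_inj c c') => ik jl; rewrite ik jl eqxx in kl.
Qed.

(** Near a point of a chamber the fibre length is affine, and near a point
    outside the hull it vanishes; so the sequence is eventually constant. *)
Lemma cvg_diff_quot u : ~ wall lam al ga (P u) ->
  (diff_quot n u)%:E @[n --> \oo] --> (fibre_derivative u)%:E.
Proof.
move=> nw; have cP : P u + (@harmonic R n) *: a @[n --> \oo] --> P u.
  rewrite -[X in _ --> X]addr0; apply: cvgD; first exact: cvg_cst.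
  rewrite -[X in _ --> X](scale0r a); apply: cvgZr_tmp; exact: cvg_harmonic.
have [cu|ncu] := pselect (conv x [set: 'I_d.+2] (P u)).
  have [i [j c]] := conv_chamber F cu nw.
  apply: cvg_near_cst; near=> n.
  have cn : chamber lam al ga i j (P u + n.+1%:R^-1 *: a).
    by near: n; exact: (cP _ (chamber_near c)).
  rewrite (fibre_derivativeE c) /diff_quot.
  rewrite (fibre_length_chamber cn) (fibre_length_chamber c).
  rewrite /ratio !affineD !dotpZr dotpDl dotpNl; congr (_%:E).
  transitivity (n.+1%:R * n.+1%:R^-1 *
    (dotp (slope lam al i) a - dotp (slope lam al j) a)); first by ring.
  by rewrite mulfV ?mul1r// pnatr_eq0.
have gu : gap (P u) < 0 by rewrite ltNge; apply/negP => /gap_conv.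
have near_neg : \forall z \near P u, gap z < 0.
  exact: (@cvgr_lt _ _ _ _ gap _ (@continuous_gap (P u)) _ gu).
have -> : fibre_derivative u = 0.
  rewrite /fibre_derivative big1// => -[k l] _ /=.
  by rewrite indicE memNset ?mulr0// => /(chamber_conv F).
apply: cvg_near_cst; near=> n; rewrite /diff_quot (fibre_length_outside ncu).
rewrite (_ : fibre_length _ = 0) ?subrr ?mulr0//; apply/max_idPl/ltW.
near: n; exact: (cP _ near_neg).
Unshelve. all: by end_near. Qed.

(** The derivative of the fibre length has integral zero, as the limit of
    difference quotients with integral zero; dominated convergence applies since
    these are uniformly bounded and supported in a common box. *)
Lemma integral_fibre_derivative : injective x ->
  \sum_p dotp (slope lam al p.1 - slope lam al p.2) a *
    volume lam al ga p.1 p.2 = 0.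
Proof.
move=> xinj; have [N [mN N0 wN]] := wall_null F xinj.
have [B HB] := diff_quot_support.
have [|||||_ _] := @dominated_convergence _ _ _ (lebesgue_tuple d)
  setT measurableT (fun n u => (diff_quot n u)%:E)
  (fun u => (fibre_derivative u)%:E)
  (fun u => (variation lam al a *+ 2 * \1_(box B) u)%:E).
- by move=> n; apply/measurable_EFinP; exact: measurable_diff_quot.
- apply/measurable_EFinP; apply: measurable_sum => p.
  apply: measurable_funM; first exact: measurable_cst.
  by apply: measurable_indic; exact: measurable_chamber.
- exists N; split=> // u /= /not_implyP[_ nc]; apply: wN; apply: contrapT => nw.
  by apply: nc; exact: cvg_diff_quot.
- apply: integrable_scaled_indic; first exact: measurable_box.
  exact: lebesgue_tuple_box_lty.
- apply: aeW => u n _; rewrite lee_fin indicE.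
  have [uB|uB] := boolP (u \in box B); first by rewrite mulr1 diff_quot_bound.
  by rewrite HB ?normr0 ?mulr0//; move: uB; rewrite notin_setE.
rewrite (_ : (fun n => _) = fun=> 0%E); last first.
  by apply/funext => n /=; exact: integral_diff_quot.
move=> /cvg_lim; rewrite lim_cst// => /(_ (@ereal_hausdorff R)) E.
have := integral_step (mu := lebesgue_tuple d)
  (fun p => dotp (slope lam al p.1 - slope lam al p.2) a)
  (fun p : 'I_d.+2 * 'I_d.+2 => measurable_chamber lam al ga p.1 p.2)
  (fun p => chamber_lty F p.1 p.2).
by rewrite -[X in X = _]E => -[].
Qed.

End Direction.
End FibreLength.

(** * Energies of the two triangulations *)

Section Dirichlet.
Context {R : realType} {d : nat}.
Variables (x : 'I_d.+2 -> 'rV[R]_d).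
Implicit Types (lam : 'I_d.+2 -> R) (al : 'I_d.+2 -> 'rV[R]_d).
Implicit Types (ga : 'I_d.+2 -> R).
Implicit Types (t : {set {set 'I_d.+2}}) (Y : 'I_d.+2 -> R).

(** The value of the functional for the triangulation whose simplices are those
    omitting a vertex [i] with [0 < lam i]. *)
Definition energy lam al ga Y : R :=
  \sum_p sqnorm (\sum_k Y k *: al k - defect lam Y *: slope lam al p.1) *
    volume lam al ga p.1 p.2.

Lemma DF_energy lam al ga t Y : injective x -> radon_frame x lam al ga ->
  is_triangulation x t ->
  (forall s, s \in t -> exists2 i, 0 < lam i & s = [set~ i]%SET) ->
  DF x t Y = (energy lam al ga Y)%:E.
Proof.
move=> xinj F ht tp; have [i0 p0] := exists_pos F.
have [N [mN N0 wN]] := wall_null F xinj.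
rewrite /DF integral_mkcond.
rewrite -(integral_step (mu := lebesgue_tuple d) _
  (fun p => measurable_chamber lam al ga p.1 p.2)
  (fun p => chamber_lty F p.1 p.2)).
apply: (ge0_eq_integral_off_null mN N0).
- by move=> u; rewrite patchE; case: ifP => _ //; rewrite lee_fin sqnorm_ge0.
- move=> u; rewrite lee_fin sumr_ge0// => p _.
  by rewrite mulr_ge0 ?sqnorm_ge0.
move=> u nu; have nw : ~ wall lam al ga (rV_of_tuple u) by move=> /wN.
rewrite patchE; case: ifPn => cu.
  have [i [j c]] := conv_chamber F (set_mem cu) nw.
  rewrite (grad_interpolant F Y p0 ht tp c) (bigD1 (i, j))//=.
  rewrite indicE mem_set// mulr1 [X in _ = (_ + X)%:E]big1 ?addr0//.
  move=> -[k l] /= kl.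
  rewrite indicE memNset ?mulr0// => c'.
  by case: (chamber_inj c c') => ik jl; rewrite ik jl eqxx in kl.
rewrite big1// => -[k l] _ /=; rewrite indicE memNset ?mulr0// => c.
by move: cu; rewrite notin_setE; apply; exact: chamber_conv c.
Qed.

(** Replacing [lam] by [- lam] exchanges the roles of the two indices of a
    chamber, and changes the sign of both the defect and the slopes. *)
Lemma energy_opp lam al ga Y : energy (fun i => - lam i) al ga Y =
  \sum_p sqnorm (\sum_k Y k *: al k - defect lam Y *: slope lam al p.2) *
    volume lam al ga p.1 p.2.
Proof.
have dN : defect (fun i => - lam i) Y = - defect lam Y.
  by rewrite /defect -sumrN; apply: eq_bigr => k _; rewrite mulNr.
(* The chamber [(i, j)] for [- lam] is the chamber [(j, i)] for [lam]. *)
have swap_inj : injective (fun p : 'I_d.+2 * 'I_d.+2 => (p.2, p.1)).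
  by move=> [i j] [k l] [-> ->].
rewrite /energy dN (reindex_inj swap_inj)/=.
apply: eq_bigr => -[i j] _ /=.
rewrite slope_opp /volume chamber_opp.
have -> : - defect lam Y *: - slope lam al j = defect lam Y *: slope lam al j.
  by rewrite scaleNr scalerN opprK.
by [].
Qed.

(** Expand the squares: the squared norm of the common part cancels, and the
    mixed terms sum to zero by [integral_fibre_derivative]. *)
Lemma energy_opp_sub lam al ga Y : injective x -> radon_frame x lam al ga ->
  energy lam al ga Y - energy (fun i => - lam i) al ga Y =
  defect lam Y ^+ 2 *
  \sum_p (sqnorm (slope lam al p.1) - sqnorm (slope lam al p.2)) *
    volume lam al ga p.1 p.2.
Proof.
move=> xinj F; have [i0 p0] := exists_pos F.
have [j0 n0] := exists_pos (radon_frame_opp F).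
set a := \sum_k Y k *: al k.
have := integral_fibre_derivative F p0 n0 a xinj.
set S := \sum_p _ => S0.
rewrite energy_opp /energy -/a; move: (defect lam Y) => C.
have E0 : - (2 * C) * S = 0 by rewrite S0 mulr0.
rewrite -sumrB -[RHS]addr0 -[X in _ = _ + X]E0 /S !mulr_sumr -big_split/=.
apply: eq_bigr => p _; rewrite !sqnormB_scale dotpDl dotpNl; ring.
Qed.

End Dirichlet.

Theorem theorem6 (R : realType) (d : nat) (x : 'I_d.+2 -> 'rV[R]_d)
    (hx : general_position x)
    (t1 t2 : {set {set 'I_d.+2}})
    (ht1 : is_triangulation x t1) (ht2 : is_triangulation x t2)
    (ht12 : t1 <> t2) :
  exists tstar : {set {set 'I_d.+2}},
    (tstar = t1 \/ tstar = t2) /\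
    forall Y : 'I_d.+2 -> R,
      DF x tstar Y = Order.min (DF x t1 Y) (DF x t2 Y).
Proof.
have [xinj _ _] := hx; have [lam [al [ga F]]] := exists_radon_frame hx.
have cmp : (forall Y, DF x t1 Y <= DF x t2 Y)%E \/
    (forall Y, DF x t2 Y <= DF x t1 Y)%E.
  pose K := \sum_p (sqnorm (slope lam al p.1) - sqnorm (slope lam al p.2)) *
    volume lam al ga p.1 p.2.
  have energies t : is_triangulation x t ->
      (forall Y, DF x t Y = (energy lam al ga Y)%:E) \/
      (forall Y, DF x t Y = (energy (fun i => - lam i) al ga Y)%:E).
    move=> ht; have [tp|tn] := triangulation_signs F ht; [left|right] => Y.
      exact: DF_energy.
    apply: DF_energy => //; first exact: radon_frame_opp.
    by move=> s /tn[i li ->]; exists i => //; rewrite oppr_gt0.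
  pose E Y := energy lam al ga Y.
  pose E' Y := energy (fun i => - lam i) al ga Y.
  have ordered : (forall Y, E Y <= E' Y) \/ (forall Y, E' Y <= E Y).
    have [K0|/ltW K0] := leP K 0; [left|right] => Y.
      by rewrite -subr_le0 (energy_opp_sub _ xinj F) mulr_ge0_le0 ?sqr_ge0.
    by rewrite -subr_ge0 (energy_opp_sub _ xinj F) mulr_ge0 ?sqr_ge0.
  case: (energies _ ht1) => E1; case: (energies _ ht2) => E2.
  - by left=> Y; rewrite E1 E2.
  - by case: ordered => H; [left|right] => Y; rewrite E1 E2 lee_fin.
  - by case: ordered => H; [right|left] => Y; rewrite E1 E2 lee_fin.
  - by left=> Y; rewrite E1 E2.
case: cmp => H; [exists t1|exists t2]; split; auto => Y; apply/esym.
  by apply/min_idPl; exact: H.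
by apply/min_idPr; exact: H.
Qed.
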